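(* For all $x>0$, $\tau>0$, $\delta>0$ and all positive integers $M,N$, $$|K_{i\tau}(x)|\le\frac{\sqrt\pi}{\sqrt{\tau\sinh(\pi\tau)}}\;\bigl[S\bigr]^{1/2},$$ where $$\begin{aligned}S={}&\frac{2}{\sqrt{\pi x}}(1+2\tau)(1+\tau)^{-\delta}+\frac{4\sqrt x}{\sqrt\pi}\left[(1+\tau)^\delta-1\right]+1+2b\sqrt{2x}\left(1+\alpha+\frac{3\alpha^2}{10}\right)^{1/2}\\&+\frac{4\sqrt x}{\pi}\left[\sum_{n=1}^{N-1}2^{2n-1}\Gamma\left(2n-\tfrac12\right)B\left(2n+\tfrac32,2n-\tfrac12\right)+\sum_{n=0}^{M-1}4^n\,\Gamma\left(2n+\tfrac12\right)B\left(2n+\tfrac52,2n+\tfrac12\right)\right]\\&+\frac{2\sqrt x}{\pi^2}\left[4^N\,\Gamma\left(2N-\tfrac32\right)B\left(2N-\tfrac32,2N+\tfrac12\right)+4^{M-1}\,\Gamma\left(2M-\tfrac12\right)B\left(2M-\tfrac12,2M+\tfrac32\right)\right].\end{aligned}$$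
   Context: $K_{i\tau}(x)=\int_0^\infty e^{-x\cosh t}\cos(\tau t)\,dt$ ($x>0$) is the Macdonald function (modified Bessel function of the second kind) of imaginary index; $\Gamma$ is the Euler gamma function and $B(z,w)=\Gamma(z)\Gamma(w)/\Gamma(z+w)$ the Euler beta function. $b=0.674885\ldots$ is the Landau constant ($b=2^{1/3}\sup_{t\in\mathbb{R}}\mathrm{Ai}(t)$, with $\mathrm{Ai}$ the Airy function) and $\alpha=1.855757\ldots$ ($\alpha=2^{-1/3}|a_1|$, where $a_1=-2.33810\ldots$ is the largest, i.e. least negative, zero of $\mathrm{Ai}$). Empty sums are zero. *)

(* Defs.v *)
From HB Require Import structures.
From mathcomp Require Import all_boot all_order all_algebra.
From mathcomp Require Import all_classical all_reals all_analysis.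

Set Implicit Arguments.
Unset Strict Implicit.
Unset Printing Implicit Defensive.

Import Order.TTheory GRing.Theory Num.Theory.
Import numFieldNormedType.Exports.

Local Open Scope classical_set_scope.
Local Open Scope ring_scope.

Section SpecialFunctions.
Context {R : realType}.
Implicit Types t u x z w tau : R.

Local Notation mu := (@lebesgue_measure R).

Definition cosh t : R := (expR t + expR (- t)) / 2.

Definition sinh t : R := (expR t - expR (- t)) / 2.

(* The Macdonald function $K_{i\tau}(x)$; the integral converges absolutely
   for x > 0. *)
Definition macdonaldK tau x : R :=
  (\int[mu]_(t in `[0%R, +oo[) (expR (- x * cosh t) * cos (tau * t)))%R.

(* Meaningful for z > 0, where the integral converges absolutely. *)
Definition Gamma z : R :=
  (\int[mu]_(t in `]0%R, +oo[) (t `^ (z - 1) * expR (- t)))%R.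

Definition Beta z w : R := Gamma z * Gamma w / Gamma (z + w).

(* The integral over the half-line is only conditionally convergent, hence
   the limit of the integrals over [0, u]. *)
Definition Airy t : R :=
  pi^-1 * lim ((fun u =>
    (\int[mu]_(v in `[0%R, u]) cos (v ^+ 3 / 3 + t * v))%R) @ +oo).

Definition Airy_zeros : set R := [set a | Airy a = 0].

(* The largest zero of Ai, $a_1 = -2.33810\ldots$ ([get] is Hilbert's choice
   operator; a largest element of a set is unique). *)
Definition airy_a1 : R := get (Airy_zeros `&` ubound Airy_zeros).

(* 0.674885... *)
Definition landau_b : R := 2 `^ 3^-1 * sup (range Airy).

(* 1.855757... *)
Definition landau_alpha : R := 2 `^ (- 3^-1) * `|airy_a1|.

End SpecialFunctions.

Arguments airy_a1 R : clear implicits.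
Arguments landau_b R : clear implicits.
Arguments landau_alpha R : clear implicits.

(* Main.v *)
Require Import Defs.
From mathcomp Require Import all_boot all_order all_algebra.
From mathcomp Require Import all_classical all_reals all_analysis.
From mathcomp Require Import measurable_realfun ring lra.

Set Implicit Arguments.
Unset Strict Implicit.
Unset Printing Implicit Defensive.

Import Order.TTheory GRing.Theory Num.Theory.
Import numFieldNormedType.Exports.

Local Open Scope classical_set_scope.
Local Open Scope ring_scope.

(** Write [F = tau sinh(pi tau) K^2 / pi]. Let [S] be the bracket of the
    statement, [y = (1 + tau)^delta] and [q = sqrt(tau + 1/2)].

    Lower bound of [S]. All its terms are nonnegative; in particular [landau_b]
    is, because [Ai(t) >= - 1/t] for every [t > 0]. The term [n = 0] of the second sum
    is at least [2 sqrt x], since [Gamma(1/2) B(5/2, 1/2) >= pi / 2]. As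
    [sqrt pi <= 2], adding it to the two terms with [delta] gives at least
    [2 q^2 / (sqrt x y) + 2 sqrt x y >= 4 q], so that [S >= 1 + 4 q].

    Upper bound of [F]. The integrand [exp(- x cosh z + i tau z)] has zero imaginary part
    on the imaginary axis, so [K] is the real part of its integral along any
    path from [+ i oo] to [+ oo]. Take the vertical half-line
    [Re z = t0] down to [t0 + i (pi/2 - e)], followed by a horizontal
    half-line, where [x cosh t0 = tau] (or [t0 = 0] if [x > tau]).
    On the vertical part the modulus is at most
    [exp(- pi tau / 2 - tau (r - sin r))] at height [pi/2 + r], and on the
    horizontal part it is dominated by a Gaussian. Choosing [e] and [h] (where
    the concave function [sin] is replaced by its tangent) of order
    [tau^(-1/2)] and [tau^(-1/4)] yields [F <= 1 + 4 q]. *)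

(** * Elementary inequalities for circular, hyperbolic and exponential functions *)

Section ElementaryBounds.
Context {R : realType}.
Implicit Types (f df : R -> R) (a b h s x y : R).

Lemma derivable_continuous f : (forall x, derivable f x 1) -> continuous f.
Proof. by move=> df x; apply/differentiable_continuous/derivable1_diffP. Qed.

(** The ladder for the Taylor bounds below: the difference of the two sides of each bound has as
    derivative the difference in the bound before it. *)
Lemma is_derive_ge0 f df : (forall x, is_derive x 1 f (df x)) ->
  (forall x, 0 <= x -> 0 <= df x) -> 0 <= f 0 -> forall x, 0 <= x -> 0 <= f x.
Proof.
move=> dfE df0 f0 x x0; apply: (le_trans f0).
apply: (@ger0_derive1_ndecr _ f 0 x _ _ _ 0 x (lexx 0) x0 (lexx x)).
- by move=> y _; have [] := dfE y.
- move=> y; rewrite in_itv /= => /andP[y0 _]; rewrite derive1E.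
  by have [_ ->] := dfE y; apply/df0/ltW.
- by apply: continuous_subspaceT; apply: derivable_continuous => y; have [] := dfE y.
Qed.

Lemma sin_le x : 0 <= x -> sin x <= x.
Proof.
move=> x0; rewrite -subr_ge0.
apply: (@is_derive_ge0 (fun x => x - sin x) (fun x => 1 - cos x)) => //.
by rewrite sin0 subrr.
Qed.

Lemma cos_ge2 x : 0 <= x -> 1 - x ^+ 2 / 2 <= cos x.
Proof.
move=> x0; rewrite -subr_ge0.
apply: (@is_derive_ge0 (fun x => cos x - (1 - x ^+ 2 / 2)) (fun x => x - sin x)).
- by move=> y; apply: is_derive_eq; rewrite /GRing.scale/=; field.
- by move=> y y0; rewrite subr_ge0 sin_le.
- by rewrite cos0 expr0n/= mul0r subr0 subrr.
- exact: x0.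
Qed.

Lemma sin_ge3 x : 0 <= x -> x - x ^+ 3 / 6 <= sin x.
Proof.
move=> x0; rewrite -subr_ge0.
apply: (@is_derive_ge0 (fun x => sin x - (x - x ^+ 3 / 6))
  (fun x => cos x - (1 - x ^+ 2 / 2))).
- by move=> y; apply: is_derive_eq; rewrite /GRing.scale/=; field.
- by move=> y y0; rewrite subr_ge0 cos_ge2.
- by rewrite sin0 expr0n/= mul0r subr0 subrr.
- exact: x0.
Qed.

Lemma cos_le4 x : 0 <= x -> cos x <= 1 - x ^+ 2 / 2 + x ^+ 4 / 24.
Proof.
move=> x0; rewrite -subr_ge0.
apply: (@is_derive_ge0 (fun x => 1 - x ^+ 2 / 2 + x ^+ 4 / 24 - cos x)
  (fun x => sin x - (x - x ^+ 3 / 6))).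
- by move=> y; apply: is_derive_eq; rewrite /GRing.scale/=; field.
- by move=> y y0; rewrite subr_ge0 sin_ge3.
- by rewrite cos0 !expr0n/= !mul0r subr0 addr0 subrr.
- exact: x0.
Qed.

Lemma sin_le5 x : 0 <= x -> sin x <= x - x ^+ 3 / 6 + x ^+ 5 / 120.
Proof.
move=> x0; rewrite -subr_ge0.
apply: (@is_derive_ge0 (fun x => x - x ^+ 3 / 6 + x ^+ 5 / 120 - sin x)
  (fun x => 1 - x ^+ 2 / 2 + x ^+ 4 / 24 - cos x)).
- by move=> y; apply: is_derive_eq; rewrite /GRing.scale/=; field.
- by move=> y y0; rewrite subr_ge0 cos_le4.
- by rewrite sin0 !expr0n/= !mul0r subr0 addr0 subrr.
- exact: x0.
Qed.

Lemma cos_ge6 x : 0 <= x -> 1 - x ^+ 2 / 2 + x ^+ 4 / 24 - x ^+ 6 / (24 * 30) <= cos x.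
Proof.
move=> x0; rewrite -subr_ge0.
apply: (@is_derive_ge0 (fun x => cos x - (1 - x ^+ 2 / 2 + x ^+ 4 / 24 - x ^+ 6 / (24 * 30)))
  (fun x => x - x ^+ 3 / 6 + x ^+ 5 / 120 - sin x)).
- by move=> y; apply: is_derive_eq; rewrite /GRing.scale/=; field.
- by move=> y y0; rewrite subr_ge0 sin_le5.
- by rewrite cos0 !expr0n/= !mul0r !subr0 addr0 subrr.
- exact: x0.
Qed.

(** The degree 6 minorant of [cos] is positive at 3/2, whereas [pi < 3] would place 3/2 beyond the
    zero pi/2. *)
Lemma pi_ge3 : 3 <= pi :> R.
Proof.
rewrite leNgt; apply/negP => pi3; have pi2 := pi_ge2 R.
have : cos (3 / 2) < cos (pi / 2) :> R.
  rewrite ltr_cos ?in_itv/=; first lra.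
    by apply/andP; split; lra.
  by apply/andP; split; lra.
rewrite cos_pihalf; have : 0 <= 3 / 2 :> R by lra.
by move=> /cos_ge6; lra.
Qed.

(** Dually, the degree 4 majorant of [cos] is negative at 8/5. *)
Lemma pi_le : pi <= 16 / 5 :> R.
Proof.
rewrite leNgt; apply/negP => pi3.
have : cos (pi / 2) < cos (8 / 5) :> R.
  rewrite ltr_cos ?in_itv/=; first lra.
    by apply/andP; split; lra.
  by apply/andP; split; lra.
rewrite cos_pihalf; have : 0 <= 8 / 5 :> R by lra.
by move=> /cos_le4; lra.
Qed.

(** In the addition formula both coefficients [sin h] and [cos h] are nonnegative, so [cos s <= 1]
    and [sin s <= s] suffice; [s] may thus be arbitrarily large. *)
Lemma sin_tangent h s : 0 <= h <= pi / 2 -> 0 <= s -> sin (h + s) <= sin h + s * cos h.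
Proof.
move=> /andP[h0 hpi] s0; rewrite sinD.
have sh : 0 <= sin h by apply: sin_ge0_pi; rewrite h0; have := pi_ge0 R; lra.
have ch : 0 <= cos h by apply: cos_ge0_pihalf; apply/andP; split; have := pi_ge0 R; lra.
have := ler_wpM2l sh (cos_le1 s); have := ler_wpM2l ch (sin_le s0); lra.
Qed.

Lemma expRN_le_inv y : 0 < y -> expR (- y) <= y^-1.
Proof.
move=> y0; rewrite expRN lef_pV2 ?posrE ?expR_gt0//.
by have := expR_ge1Dx y; lra.
Qed.

Lemma sinh_ge x : 0 <= x -> x <= sinh x.
Proof.
move=> x0; rewrite -subr_ge0.
apply: (@is_derive_ge0 (fun x => sinh x - x) (fun x => cosh x - 1)) => //.
- by move=> y; rewrite /sinh /cosh; apply: is_derive_eq; rewrite /GRing.scale/=; field.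
- move=> y _; have eVy := expRxMexpNx_1 y.
  have : 0 <= (expR y - 1) ^+ 2 * expR (- y) by rewrite mulr_ge0 ?sqr_ge0 ?expR_ge0.
  have -> : (expR y - 1) ^+ 2 * expR (- y) =
      expR y * (expR y * expR (- y)) - 2 * (expR y * expR (- y)) + expR (- y) by ring.
  by rewrite eVy /cosh; lra.
- by rewrite /sinh oppr0 subrr mul0r addr0.
Qed.

Lemma cosh_ge2 x : 0 <= x -> 1 + x ^+ 2 / 2 <= cosh x.
Proof.
move=> x0; rewrite -subr_ge0.
apply: (@is_derive_ge0 (fun x => cosh x - (1 + x ^+ 2 / 2)) (fun x => sinh x - x)) => //.
- by move=> y; rewrite /sinh /cosh; apply: is_derive_eq; rewrite /GRing.scale/=; field.
- by move=> y y0; rewrite subr_ge0 sinh_ge.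
- by rewrite /cosh oppr0 expR0 expr0n/= mul0r; lra.
Qed.

Lemma cosh_ge x : 0 <= x -> x <= cosh x.
Proof. by move=> x0; have := cosh_ge2 x0; nra. Qed.

Lemma coshD x y : cosh (x + y) = cosh x * cosh y + sinh x * sinh y.
Proof. by rewrite /cosh /sinh opprD !expRD; field. Qed.

(** Source of the Gaussian decay along the horizontal part of the path: the product of the two
    [sinh] in the addition formula is dropped. *)
Lemma cosh_shift_ge x y : 0 <= x -> 0 <= y -> cosh x * (1 + y ^+ 2 / 2) <= cosh (x + y).
Proof.
move=> x0 y0; rewrite coshD -[leLHS]addr0 lerD//.
  by rewrite ler_wpM2l ?cosh_ge2// (le_trans x0)// cosh_ge.
by apply: mulr_ge0; [apply: (le_trans x0)|apply: (le_trans y0)]; exact: sinh_ge.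
Qed.

Lemma cosh_surj y : 1 <= y -> exists2 t, 0 <= t & cosh t = y.
Proof.
(* [ln r] is the explicit inverse of [cosh], since 1/r = y - sqrt(y^2 - 1). *)
move=> y1; pose r := y + Num.sqrt (y ^+ 2 - 1).
have s0 := sqrtr_ge0 (y ^+ 2 - 1).
have sE : Num.sqrt (y ^+ 2 - 1) ^+ 2 = y ^+ 2 - 1 by rewrite sqr_sqrtr//; nra.
have r0 : 0 < r by rewrite /r; lra.
exists (ln r); first by rewrite ln_ge0// /r; lra.
rewrite /cosh expRN lnK ?posrE//.
have -> : r^-1 = y - Num.sqrt (y ^+ 2 - 1).
  by apply: (mulfI (lt0r_neq0 r0)); rewrite mulfV ?lt0r_neq0// /r; lra.
by rewrite /r; lra.
Qed.

Lemma ler_of_sqr a b : 0 <= b -> a ^+ 2 <= b ^+ 2 -> a <= b.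
Proof. by move=> b0 ab; rewrite leNgt; apply/negP => ba; nra. Qed.

Lemma ler_sqr_nneg a b : 0 <= a -> a <= b -> a ^+ 2 <= b ^+ 2.
Proof. by move=> a0 ab; nra. Qed.

Lemma expR_le_inv x : x < 1 -> expR x <= (1 - x)^-1.
Proof.
move=> x1; rewrite -[leLHS]invrK -expRN lef_pV2 ?posrE ?expR_gt0//; last lra.
by have := expR_ge1Dx (- x); lra.
Qed.

(** Passage to the limit in [T] without limits: if [b < a], the value T = T0 + M / (a - b) makes M /
    T smaller than a - b. *)
Lemma le_of_le_addM_inv a b (M T0 : R) : 0 <= M -> 0 < T0 ->
  (forall T, T0 <= T -> a <= b + M / T) -> a <= b.
Proof.
move=> M0 T00 H; rewrite leNgt; apply/negP => ba.
have d0 : 0 < a - b by lra.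
pose T := T0 + M / (a - b).
have Mq : 0 <= M / (a - b) by rewrite divr_ge0// ltW.
have T0' : 0 < T by rewrite /T; lra.
have /H : T0 <= T by rewrite /T; lra.
have -> : M = (a - b) * (T - T0) by rewrite /T; field; lra.
have : (a - b) * (T - T0) / T < a - b.
  by rewrite ltr_pdivrMr// ltr_pM2l//; lra.
by lra.
Qed.

End ElementaryBounds.

(** * Integrals of continuous functions over compact segments *)

Section SegmentIntegral.
Context {R : realType}.
Implicit Types (f g F : R -> R) (a b c x : R).

Local Notation mu := (@lebesgue_measure R).

Lemma continuous_integrable_itv f a b :
  continuous f -> mu.-integrable `[a, b] (EFin \o f).
Proof.
move=> cf; apply: continuous_compact_integrable; first exact: segment_compact.
exact: continuous_subspaceT.
Qed.

Lemma Rintegral_itv1 f a : \int[mu]_(x in `[a, a]) f x = 0.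
Proof. by rewrite set_itv1 Rintegral_set1. Qed.

Lemma Rintegral_itv_cst a b c : a <= b -> \int[mu]_(_ in `[a, b]) c = c * (b - a).
Proof.
move=> ab; rewrite Rintegral_cst//= lebesgue_measure_itv /= lte_fin.
by case: ltgtP ab => //= <-; rewrite subrr.
Qed.

Lemma Rintegral_FTC f F a b : a <= b -> continuous f ->
  (forall x, is_derive x 1 F (f x)) -> \int[mu]_(x in `[a, b]) f x = F b - F a.
Proof.
rewrite le_eqVlt => /predU1P[-> _ _|ab cf dF]; first by rewrite Rintegral_itv1 subrr.
have cF : continuous F by apply: derivable_continuous => x; have [] := dF x.
rewrite /Rintegral (@continuous_FTC2 _ f F)//.
- exact: continuous_subspaceT.
- split.
  + by move=> x _; have [] := dF x.
  + exact/cvg_at_right_filter/cF.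
  + exact/cvg_at_left_filter/cF.
- by move=> x _; rewrite derive1E; have [_] := dF x.
Qed.

Lemma Rintegral_itv_split f a b c : a <= b -> b <= c ->
  continuous f ->
  \int[mu]_(x in `[a, c]) f x = \int[mu]_(x in `[a, b]) f x + \int[mu]_(x in `[b, c]) f x.
Proof.
move=> ab bc cf; have := @Rintegral_itvB _ f (BLeft a) (BRight c) b.
rewrite !bnd_simp => /(_ (continuous_integrable_itv _ _ cf) ab bc) /eqP.
rewrite Rintegral_itv_obnd_cbnd; last first.
  apply: integrableS (continuous_integrable_itv b c cf) => //.
  exact: subset_itv_oc_cc.
by rewrite subr_eq addrC => /eqP.
Qed.

Lemma ler_norm_Rintegral f g a b : continuous f -> continuous g ->
  (forall x, a <= x <= b -> `|f x| <= g x) ->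
  `|\int[mu]_(x in `[a, b]) f x| <= \int[mu]_(x in `[a, b]) g x.
Proof.
move=> cf cg fg; have fi := @continuous_integrable_itv f a b cf.
apply: le_trans (le_normr_Rintegral _ fi) _ => //.
apply: le_Rintegral => //.
- exact: integrable_norm.
- exact: continuous_integrable_itv.
Qed.

Lemma ler_norm_Rintegral_cst f a b c : a <= b -> continuous f ->
  (forall x, a <= x <= b -> `|f x| <= c) ->
  `|\int[mu]_(x in `[a, b]) f x| <= c * (b - a).
Proof.
move=> ab cf fc; rewrite -Rintegral_itv_cst//; apply: ler_norm_Rintegral => //.
exact: cst_continuous.
Qed.

End SegmentIntegral.

(** * Cauchy's theorem on a rectangle, in real form *)

Section Rectangle.
Context {R : realType}.
Variables u v w : R -> R -> R.
Hypothesis du : forall t th : R, is_derive th (1 : R) (u t) (w t th).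
Hypothesis dv : forall t th : R, is_derive t (1 : R) (v^~ th) (- w t th).
Hypothesis cu : forall th, continuous (u^~ th).
Hypothesis cv : forall t, continuous (v t).
Hypothesis cw : forall th, continuous (w^~ th).

Local Notation mu := (@lebesgue_measure R).

(** Differentiation under the integral sign, dominated by the constant [M], yields the integral of
    [w] in [t]; there [- v] is a primitive of [w]. *)
Lemma is_derive_Rintegral_param (a b th M e : R) : a <= b -> 0 < e ->
  (forall t s : R, a <= t <= b -> th - e <= s <= th + e -> `|w t s| <= M) ->
  is_derive th 1 (fun s => \int[mu]_(t in `[a, b]) u t s) (v a th - v b th).
Proof.
move=> ab e0 wM.
have M0 : 0 <= M.
  apply: (le_trans (normr_ge0 (w a th))); apply: wM; first by rewrite lexx ab.
  by apply/andP; split; lra.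
have pE t s : partial1of2 (fun s t => u t s) s t = w t s.
  by rewrite partial1of2E; have [_] := du t s.
have H := @cvg_differentiation_under_integral R _ _ mu (fun s t => u t s) `[a, b]
  (measurable_itv _) th (th - e) (th + e) _ _ _ (cst M).
have {H} : h^-1 *: (\int[mu]_(t in `[a, b]) u t (h + th) - \int[mu]_(t in `[a, b]) u t th)
    @[h --> 0^'] --> v a th - v b th.
  rewrite [X in _ --> X](_ : _ = \int[mu]_(t in `[a, b])
      partial1of2 (fun s t => u t s) th t); last first.
    under eq_Rintegral do rewrite pE.
    have dv' (t : R) : is_derive t 1 (fun t => - v t th : R) (w t th).
      by apply: is_derive_eq; rewrite opprK.
    by rewrite (Rintegral_FTC ab _ dv')// opprK addrC.
  apply: H.
  - by rewrite /= in_itv /=; apply/andP; split; lra.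
  - by move=> s _; apply: continuous_integrable_itv.
  - by move=> s t _ _; have [] := du t s.
  - by [].
  - by apply: continuous_integrable_itv; exact: cst_continuous.
  - move=> s t; rewrite /= !in_itv /= => /andP[s1 s2] tab.
    by rewrite pE; apply: wM => //; rewrite (ltW s1) (ltW s2).
move=> H; apply: DeriveDef; last first.
  by apply/cvg_lim => //; under eq_fun do rewrite scaler1.
by apply/cvg_ex; exists (v a th - v b th); under eq_fun do rewrite scaler1.
Qed.

(** Real part of Cauchy's theorem for u + i v, where [w] is the common value in the Cauchy-Riemann
    equation du/dth = - dv/dt. The integral over a horizontal side is differentiated in its height,
    and the derivative is integrated back. *)
Lemma rectangle_identity (a b c d M : R) : a <= b -> c <= d ->
  (forall t s : R, a <= t <= b -> c - 1 <= s <= d + 1 -> `|w t s| <= M) ->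
  \int[mu]_(t in `[a, b]) u t d - \int[mu]_(t in `[a, b]) u t c =
  \int[mu]_(s in `[c, d]) v a s - \int[mu]_(s in `[c, d]) v b s.
Proof.
move=> ab; rewrite le_eqVlt => /predU1P[-> _|cd wM].
  by rewrite !Rintegral_itv1 !subrr.
pose U (s : R) := \int[mu]_(t in `[a, b]) u t s.
(* The margin 1/2 includes the endpoints [c] and [d], and leaves another 1/2 for the neighbourhood
   on which [w] must be bounded. *)
have dU (s : R) : c - 1/2 < s < d + 1/2 -> is_derive s 1 U (v a s - v b s).
  move=> /andP[cs sd].
  have h0 : 0 < 1 / 2 :> R by lra.
  apply: (is_derive_Rintegral_param ab h0).
  move=> t s' tab /andP[s1 s2]; apply: wM => //; apply/andP; split; lra.
have cU (s : R) : c - 1/2 < s < d + 1/2 -> {for s, continuous U}.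
  move=> /dU[dUs _]; apply: differentiable_continuous.
  exact/derivable1_diffP.
rewrite -/(U d) -/(U c) -RintegralB//; last 2 first.
- exact: continuous_integrable_itv.
- exact: continuous_integrable_itv.
have cvv : continuous (fun s => v a s - v b s).
  by move=> s; apply: cvgB; exact: cv.
rewrite [RHS]/Rintegral (@continuous_FTC2 _ _ U)//.
- exact: continuous_subspaceT.
- split.
  + move=> s; rewrite in_itv /= => /andP[s1 s2].
    by have [] := dU s ltac:(apply/andP; split; lra).
  + by apply/cvg_at_right_filter/cU/andP; split; lra.
  + by apply/cvg_at_left_filter/cU/andP; split; lra.
- move=> s; rewrite in_itv /= => /andP[s1 s2]; rewrite derive1E.
  by have [_] := dU s ltac:(apply/andP; split; lra).
Qed.

End Rectangle.

(** * Deformation of the path of integration for exp(- x cosh z + i tau z) *)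

Section Contour.
Context {R : realType}.
Implicit Types (a b c d t th x tau : R).

Local Notation mu := (@lebesgue_measure R).

Global Instance is_derive_cosh t : is_derive t (1 : R) cosh (sinh t).
Proof. by rewrite /cosh /sinh; apply: is_derive_eq; rewrite /GRing.scale/=; field. Qed.

Global Instance is_derive_sinh t : is_derive t (1 : R) sinh (cosh t).
Proof. by rewrite /cosh /sinh; apply: is_derive_eq; rewrite /GRing.scale/=; field. Qed.

(** Argument and modulus come from cosh(t + i th) = cosh t cos th + i sinh t sin th. *)
Definition contour_phase x tau t th := tau * t - x * sinh t * sin th.

Definition contour_modulus x tau t th := expR (- (x * cosh t * cos th) - tau * th).

(* Real and imaginary part of exp(- x cosh z + i tau z) at z = t + i th. *)
Definition contour_re x tau t th :=
  contour_modulus x tau t th * cos (contour_phase x tau t th).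

Definition contour_im x tau t th :=
  contour_modulus x tau t th * sin (contour_phase x tau t th).

(** The Cauchy-Riemann derivative, in the role of [w] above. *)
Definition contour_der x tau t th :=
  contour_modulus x tau t th *
  ((x * cosh t * sin th - tau) * cos (contour_phase x tau t th)
   + x * sinh t * cos th * sin (contour_phase x tau t th)).

Lemma is_derive_contour_re x tau t th :
  is_derive th (1 : R) (contour_re x tau t) (contour_der x tau t th).
Proof.
rewrite /contour_re /contour_der /contour_modulus /contour_phase.
by apply: is_derive_eq; rewrite /GRing.scale/=; ring.
Qed.

Lemma is_derive_contour_im x tau t th :
  is_derive t (1 : R) (contour_im x tau ^~ th) (- contour_der x tau t th).
Proof.
rewrite /contour_im /contour_der /contour_modulus /contour_phase.
by apply: is_derive_eq; rewrite /GRing.scale/=; ring.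
Qed.

Lemma continuous_contour_rel x tau th : continuous (contour_re x tau ^~ th).
Proof.
rewrite /contour_re /contour_modulus /contour_phase; apply: derivable_continuous => t.
exact: ex_derive.
Qed.

Lemma continuous_contour_imr x tau t : continuous (contour_im x tau t).
Proof.
rewrite /contour_im /contour_modulus /contour_phase; apply: derivable_continuous => th.
exact: ex_derive.
Qed.

Lemma continuous_contour_derl x tau th : continuous (contour_der x tau ^~ th).
Proof.
rewrite /contour_der /contour_modulus /contour_phase; apply: derivable_continuous => t.
exact: ex_derive.
Qed.

Lemma norm_contour_re x tau t th :
  `|contour_re x tau t th| <= contour_modulus x tau t th.
Proof.
by rewrite normrM ger0_norm ?expR_ge0// ler_piMr ?expR_ge0// cos_max.
Qed.

Lemma norm_contour_im x tau t th :
  `|contour_im x tau t th| <= contour_modulus x tau t th.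
Proof.
by rewrite normrM ger0_norm ?expR_ge0// ler_piMr ?expR_ge0// sin_max.
Qed.

Lemma cosh_ge0 t : 0 <= cosh t.
Proof. by rewrite divr_ge0// addr_ge0// expR_ge0. Qed.

Lemma cosh_le_expR t b : `|t| <= b -> cosh t <= expR b.
Proof.
rewrite ler_norml => /andP[bt tb].
have h1 : expR t <= expR b by rewrite ler_expR.
have h2 : expR (- t) <= expR b by rewrite ler_expR; lra.
by rewrite /cosh; lra.
Qed.

Lemma norm_sinh_le_cosh t : `|sinh t| <= cosh t.
Proof.
have h1 := expR_ge0 t; have h2 := expR_ge0 (- t).
by rewrite /sinh /cosh ler_norml; apply/andP; split; lra.
Qed.

(** Supplies the dominating constant of [rectangle_identity]; |a| + |b| and |c| + |d| bound the two
    coordinates on the rectangle. *)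
Lemma contour_der_bounded x tau a b c d : 0 <= x -> 0 <= tau -> exists M : R,
  forall t th : R, a <= t <= b -> c <= th <= d -> `|contour_der x tau t th| <= M.
Proof.
move=> x0 tau0; pose B := `|a| + `|b|; pose D := `|c| + `|d|.
have between (p q r : R) : p <= r <= q -> `|r| <= `|p| + `|q|.
  move=> /andP[pr rq]; have := ler_norm q; have := ler_norm (- p).
  have := normr_ge0 p; have := normr_ge0 q; rewrite normrN ler_norml => *.
  by apply/andP; split; lra.
exists (expR (x * expR B + tau * D) * (x * expR B + tau + x * expR B)).
move=> t th /between/cosh_le_expR cB /between thD; have s0 := norm_sinh_le_cosh t.
have c0 := cosh_ge0 t.
have xc0 : 0 <= x * cosh t by rewrite mulr_ge0.
have xcB : x * cosh t <= x * expR B by rewrite ler_wpM2l.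
rewrite normrM ger0_norm ?expR_ge0//; apply: ler_pM => //.
- exact: expR_ge0.
- rewrite ler_expR lerD//.
    apply: (le_trans _ xcB); have : 0 <= x * cosh t * (1 + cos th).
      by rewrite mulr_ge0//; have := cos_geN1 th; lra.
    by lra.
  rewrite -mulrN ler_wpM2l// (le_trans _ thD)//.
  by rewrite -normrN ler_norm.
- apply: (le_trans (ler_normD _ _)); apply: lerD.
  + rewrite normrM (le_trans (ler_piMr _ (cos_max _)))//.
    apply: (le_trans (ler_normB _ _)); rewrite (ger0_norm tau0) lerD2r.
    rewrite normrM ger0_norm// (le_trans _ xcB)// ler_piMr// sin_max//.
  + rewrite normrM (le_trans (ler_piMr _ (sin_max _)))//.
    rewrite normrM (le_trans (ler_piMr _ (cos_max _)))//.
    by rewrite normrM ger0_norm// (le_trans _ xcB)// ler_wpM2l.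
Qed.

Lemma contour_rectangle x tau a b c d : 0 <= x -> 0 <= tau -> a <= b -> c <= d ->
  \int[mu]_(t in `[a, b]) contour_re x tau t d - \int[mu]_(t in `[a, b]) contour_re x tau t c =
  \int[mu]_(s in `[c, d]) contour_im x tau a s - \int[mu]_(s in `[c, d]) contour_im x tau b s.
Proof.
move=> x0 tau0 ab cd.
have [M wM] := contour_der_bounded a b (c - 1) (d + 1) x0 tau0.
apply: (rectangle_identity _ _ _ _ _ ab cd wM).
- exact: is_derive_contour_re.
- exact: is_derive_contour_im.
- exact: continuous_contour_rel.
- exact: continuous_contour_imr.
- exact: continuous_contour_derl.
Qed.

Lemma contour_im0 x tau th : contour_im x tau 0 th = 0.
Proof.
have phase0 : contour_phase x tau 0 th = 0.
  by rewrite /contour_phase /sinh oppr0 subrr; ring.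
by rewrite /contour_im phase0 sin0 mulr0.
Qed.

(* The path from 0 to T along the real axis is deformed into the imaginary
   axis up to i Th, the segment to t0 + i Th, the vertical one down to
   t0 + i th0, the horizontal one to T + i th0 and the vertical one down to T;
   on the imaginary axis the imaginary part vanishes. *)
Lemma contour_deformation x tau t0 T th0 Th : 0 <= x -> 0 <= tau ->
  0 <= t0 <= T -> 0 <= th0 <= Th ->
  \int[mu]_(t in `[0, T]) contour_re x tau t 0 =
  \int[mu]_(t in `[0, t0]) contour_re x tau t Th
  + \int[mu]_(t in `[t0, T]) contour_re x tau t th0
  + \int[mu]_(s in `[th0, Th]) contour_im x tau t0 s
  + \int[mu]_(s in `[0, th0]) contour_im x tau T s.
Proof.
move=> x0 tau0 /andP[t00 t0T] /andP[th00 th0Th].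
have := contour_rectangle x0 tau0 t00 (le_trans th00 th0Th).
under [X in _ = X - _ -> _]eq_Rintegral do rewrite contour_im0.
rewrite (Rintegral_itv_cst _ (le_trans th00 th0Th)) mul0r.
have := contour_rectangle x0 tau0 t0T th00.
rewrite (Rintegral_itv_split t00 t0T (@continuous_contour_rel x tau 0)).
rewrite (Rintegral_itv_split th00 th0Th (@continuous_contour_imr x tau t0)).
have alg (a1 b1 c1 c2 d1 d2 e1 : R) : d1 - d2 = c1 - e1 ->
    a1 - b1 = 0 - (c1 + c2) -> b1 + d2 = a1 + d1 + c2 + e1 by lra.
exact: alg.
Qed.

End Contour.

(** * Exponential and Gaussian integrals *)

Section HalfLineIntegrals.
Context {R : realType}.
Implicit Types (a b c k t T : R).

Local Notation mu := (@lebesgue_measure R).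

Lemma integral_expRN k a : 0 < k ->
  (\int[mu]_(t in `[a, +oo[) (expR (- (k * t)))%:E)%E = (expR (- (k * a)) / k)%:E.
Proof.
move=> k0.
have dF t : is_derive t (1 : R) (fun t => - (expR (- (k * t)) / k)) (expR (- (k * t))).
  by apply: is_derive_eq; rewrite /GRing.scale/=; field; lra.
have cF : continuous (fun t => - (expR (- (k * t)) / k)).
  by apply: derivable_continuous => t; have [] := dF t.
rewrite (@ge0_continuous_FTC2y _ _ (fun t => - (expR (- (k * t)) / k)) a 0).
- by rewrite -EFinB; congr (_%:E); ring.
- by move=> t _; exact: expR_ge0.
- by apply: continuous_subspaceT; apply: derivable_continuous => t; exact: ex_derive.
- rewrite -oppr0 -(mul0r k^-1); apply: cvgN; apply: cvgM; last exact: cvg_cst.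
  apply: (@cvg_comp _ _ _ (fun t => k * t) (fun t => expR (- t)) _ +oo).
    exact: gt0_cvgMry.
  exact: cvgr_expR.
- by move=> t _; have [] := dF t.
- exact/cvg_at_right_filter/cF.
- by move=> t _; rewrite derive1E; have [_] := dF t.
Qed.

Lemma integrable_expRN k a : 0 < k ->
  mu.-integrable `[a, +oo[ (fun t => (expR (- (k * t)))%:E).
Proof.
move=> k0; apply/integrableP; split.
  apply/measurable_EFinP; apply: measurable_funTS; apply: continuous_measurable_fun.
  by apply: derivable_continuous => t; exact: ex_derive.
rewrite (_ : (fun _ => _) = (fun t => (expR (- (k * t)))%:E)); last first.
  by apply/funext => t; rewrite /= ger0_norm// expR_ge0.
by rewrite integral_expRN// ltry.
Qed.

(** The substitution c (t - a) leads to a segment starting at 0, where the half-line value sqrt(pi)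
    / 2 is an upper bound. *)
Lemma Rintegral_itv_gauss_le c a b : 0 < c -> a <= b ->
  \int[mu]_(t in `[a, b]) gauss_fun (c * (t - a)) <= Num.sqrt pi / (2 * c).
Proof.
move=> c0 ab.
have gauss_le (y : R) : 0 <= y -> \int[mu]_(t in `[0, y]) gauss_fun t <= Num.sqrt pi / 2.
  move=> y0; rewrite -lee_fin fineK; last first.
    apply: integrable_fin_num => //.
    exact: (continuous_integrable_itv _ _ continuous_gauss_fun).
  rewrite -(integral0y_gauss (R := R)); apply: ge0_subset_integral => //.
  - apply/measurable_EFinP; apply: measurable_funTS; exact: measurable_gauss_fun.
  - by move=> t _; rewrite lee_fin gauss_fun_ge0.
  - by apply: subset_itvl; rewrite bnd_simp.
pose F t := c * (t - a).
have dF (t : R) : is_derive t (1 : R) F c.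
  by rewrite /F; apply: is_derive_eq; rewrite /GRing.scale/=; ring.
have F'E : derive1 F = cst c by apply/funext => t; rewrite derive1E; have [_] := dF t.
have cF : continuous F by apply: derivable_continuous => t; have [] := dF t.
have := @integration_by_substitution_increasing R F gauss_fun a b ab.
have -> : F a = 0 by rewrite /F subrr mulr0.
rewrite F'E => subst.
suff H : (\int[mu]_(x in `[0%R, F b]) (gauss_fun x)%:E =
    \int[mu]_(x in `[a, b]) (gauss_fun (F x) * c)%:E)%E.
  have cg : continuous (gauss_fun \o F).
    by move=> x; apply: continuous_comp; [exact: cF|exact: continuous_gauss_fun].
  have : c * \int[mu]_(t in `[a, b]) gauss_fun (F t) = \int[mu]_(t in `[0, F b]) gauss_fun t.
    rewrite mulrC -RintegralZr//; last exact: (continuous_integrable_itv _ _ cg).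
    by rewrite /Rintegral H.
  have Fb0 : 0 <= F b by rewrite /F mulr_ge0 ?subr_ge0// ltW.
  have -> : Num.sqrt pi / (2 * c) = Num.sqrt pi / 2 / c by field; lra.
  by rewrite ler_pdivlMr// mulrC => ->; exact: gauss_le.
apply: subst.
- by move=> x y _ _ xy; rewrite /F ltr_pM2l//; lra.
- by move=> x _; exact: cst_continuous.
- exact: is_cvg_cst.
- exact: is_cvg_cst.
- split; first by move=> x _; have [] := dF x.
  + exact/cvg_at_right_filter/cF.
  + exact/cvg_at_left_filter/cF.
- exact/continuous_subspaceT/continuous_gauss_fun.
Qed.

End HalfLineIntegrals.

(** * Bound of the Macdonald function with free parameters [e] and [h] *)

Section MacdonaldBound.
Context {R : realType}.
Implicit Types (e h t th x tau s T : R).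

Local Notation mu := (@lebesgue_measure R).

Lemma contour_re0 x tau t : contour_re x tau t 0 = expR (- x * cosh t) * cos (tau * t).
Proof.
rewrite /contour_re /contour_modulus /contour_phase sin0 cos0.
by congr (expR _ * cos _); ring.
Qed.

Lemma integrable_contour_re0 x tau : 0 < x ->
  mu.-integrable `[0, +oo[ (EFin \o contour_re x tau ^~ 0).
Proof.
move=> x0; apply: (le_integrable _ _ _ (integrable_expRN 0 x0)) => //.
  apply/measurable_EFinP; apply: measurable_funTS; apply: continuous_measurable_fun.
  exact: continuous_contour_rel.
move=> t; rewrite /= in_itv /= andbT => t0; rewrite lee_fin.
apply: (le_trans (norm_contour_re _ _ _ _)).
rewrite ger0_norm ?expR_ge0// /contour_modulus ler_expR cos0.
by have := ler_wpM2l (ltW x0) (cosh_ge t0); lra.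
Qed.

(** As [cosh t >= t], the tail is at most exp(- x T) / x; it is weakened to a multiple of 1 / T, the
    form that [le_of_le_addM_inv] absorbs. *)
Lemma macdonaldK_truncation x tau T : 0 < x -> 0 < T ->
  `|macdonaldK tau x| <=
  `|\int[mu]_(t in `[0, T]) contour_re x tau t 0| + (x ^+ 2)^-1 / T.
Proof.
move=> x0 T0; have int_re := integrable_contour_re0 tau x0.
have -> : macdonaldK tau x = \int[mu]_(t in `[0, +oo[) contour_re x tau t 0.
  by rewrite /macdonaldK; apply: eq_Rintegral => t _; rewrite contour_re0.
have := @Rintegral_itvB _ (contour_re x tau ^~ 0) (BLeft 0) +oo%O T int_re.
rewrite bnd_simp => /(_ (ltW T0) isT) /eqP; rewrite subr_eq => /eqP ->.
rewrite addrC (le_trans (ler_normD _ _))// lerD2l.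
have sub : [set` `]T, +oo[%R] `<=` [set` `[0, +oo[%R].
  by apply: subset_itvr; rewrite bnd_simp ltW.
have int_reT : mu.-integrable `]T, +oo[ (EFin \o contour_re x tau ^~ 0).
  exact: integrableS int_re.
have int_exp : mu.-integrable `]T, +oo[ (fun t => (expR (- (x * t)))%:E).
  by apply: integrableS (integrable_expRN 0 x0).
apply: (le_trans (le_normr_Rintegral _ int_reT)) => //.
apply: (@le_trans _ _ (\int[mu]_(t in `]T, +oo[) expR (- (x * t)))).
  apply: le_Rintegral => //; first exact: integrable_norm.
  move=> t; rewrite /= in_itv /= andbT => Tt.
  apply: (le_trans (norm_contour_re _ _ _ _)).
  rewrite /contour_modulus ler_expR cos0.
  have t0 : 0 <= t by lra.
  by have := ler_wpM2l (ltW x0) (cosh_ge t0); lra.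
rewrite Rintegral_itv_obnd_cbnd// /Rintegral integral_expRN//=.
have xT : 0 < x * T by rewrite mulr_gt0.
apply: (le_trans (ler_wpM2r _ (expRN_le_inv xT))); first by rewrite invr_ge0 ltW.
by rewrite le_eqVlt; apply/orP; left; apply/eqP; field; lra.
Qed.

(** At height pi/2 - e the cosine equals [sin e], and x cosh t >= tau (1 + (t - t0)^2 / 2). *)
Lemma contour_modulus_horizontal x tau t0 t e :
  0 < tau -> 0 <= t0 <= t -> tau <= x * cosh t0 -> 0 < e < pi / 2 ->
  contour_modulus x tau t (pi / 2 - e) <=
  expR (- (pi / 2 * tau)) * expR (tau * (e - sin e))
  * gauss_fun (Num.sqrt (tau * sin e / 2) * (t - t0)).
Proof.
move=> tau0 /andP[t00 t0t] xt0 /andP[e0 epi].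
have se : 0 < sin e by apply: sin_gt0_pihalf; rewrite e0.
have cE : cos (pi / 2 - e) = sin e by rewrite cosB cos_pihalf sin_pihalf; ring.
rewrite /contour_modulus /gauss_fun cE -!expRD ler_expR.
rewrite exprMn sqr_sqrtr; last by rewrite divr_ge0// mulr_ge0// ltW.
have x0 : 0 < x.
  by have := cosh_ge0 t0; rewrite le_eqVlt => /predU1P[c0|c0]; [move: xt0; rewrite -c0|]; nra.
have : tau * (1 + (t - t0) ^+ 2 / 2) <= x * cosh t.
  rewrite -{2}(subrKC t0 t).
  have tt : 0 <= t - t0 by lra.
  apply: le_trans (ler_wpM2l (ltW x0) (cosh_shift_ge t00 tt)); rewrite mulrA.
  by apply: ler_wpM2r => //; have := sqr_ge0 (t - t0); lra.
by move=> /(ler_wpM2r (ltW se)) H; nra.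
Qed.

(** The alternatives are the two positions of the vertical line: through the saddle point t0 + i
    pi/2, where x cosh t0 = tau, or on the imaginary axis, where the imaginary part vanishes. *)
Lemma norm_contour_im_vertical x tau t0 th :
  x * cosh t0 = tau \/ t0 = 0 ->
  `|contour_im x tau t0 th| <= expR (- (tau * (th + cos th))).
Proof.
case=> [xt0|->]; last by rewrite contour_im0 normr0 expR_ge0.
apply: (le_trans (norm_contour_im _ _ _ _)).
by rewrite /contour_modulus xt0 ler_expR; lra.
Qed.

(** At height pi/2 + r the exponent is at most - pi tau / 2 - tau (r - sin r). The range of [r] is
    cut at 0 and [h]: the increasing function r - sin r is at least - (e - sin e) on the first piece
    and at least 0 on the second; on the third, the tangent of [sin] at [h] leaves an exponential of
    rate tau (1 - cos h). *)
Lemma vertical_integral_le x tau t0 e h T :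
  0 < tau -> x * cosh t0 = tau \/ t0 = 0 ->
  0 < e < pi / 2 -> 0 < h <= pi / 2 -> pi / 2 + h <= T ->
  `|\int[mu]_(s in `[pi / 2 - e, T]) contour_im x tau t0 s| <=
  expR (- (pi / 2 * tau)) *
  (expR (tau * (e - sin e)) * e + h + (tau * (1 - cos h))^-1).
Proof.
move=> tau0 xt0 /andP[e0 epi] /andP[h0 hpi] hT.
have cim := @continuous_contour_imr R x tau t0.
have le1 : pi / 2 - e <= pi / 2 by lra.
have le2 : pi / 2 <= pi / 2 + h by lra.
rewrite (Rintegral_itv_split le1 (le_trans le2 hT) cim).
rewrite (Rintegral_itv_split le2 hT cim).
have bnd (r : R) : `|contour_im x tau t0 (pi / 2 + r)| <=
    expR (- (pi / 2 * tau)) * expR (- (tau * (r - sin r))).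
  apply: (le_trans (norm_contour_im_vertical _ xt0)).
  have -> : cos (pi / 2 + r) = - sin r by rewrite addrC cosDpihalf.
  by rewrite -expRD ler_expR; lra.
have bnd' (th y : R) : - y <= tau * (th - pi / 2 - sin (th - pi / 2)) ->
    `|contour_im x tau t0 th| <= expR (- (pi / 2 * tau)) * expR y.
  move=> H; rewrite -{1}(subrKC (pi / 2) th); apply: (le_trans (bnd _)).
  by rewrite ler_wpM2l ?expR_ge0// ler_expR; lra.
have ch : 0 < 1 - cos h.
  rewrite subr_gt0 -[ltRHS]cos0 ltr_cos ?in_itv/= ?lexx ?pi_ge0//.
  by rewrite (ltW h0)/=; lra.
rewrite (mulrDr (expR _)) (mulrDr (expR _) _ h) -addrA.
apply: (le_trans (ler_normD _ _)); apply: lerD.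
  have -> : expR (- (pi / 2 * tau)) * (expR (tau * (e - sin e)) * e) =
    expR (- (pi / 2 * tau)) * expR (tau * (e - sin e)) * (pi / 2 - (pi / 2 - e)) by ring.
  apply: ler_norm_Rintegral_cst => // th /andP[th1 th2]; apply: bnd'.
  rewrite -mulrN ler_wpM2l ?(ltW tau0)//.
  have e0' : 0 <= pi / 2 - th by lra.
  have -> : th - pi / 2 = - (pi / 2 - th) by ring.
  rewrite sinN.
  pose f := fun y : R => y - sin y.
  have : f (pi / 2 - th) <= f e.
    apply: (@ger0_derive1_ndecr _ f 0 e _ _ _ _ e) => //; last lra.
    - move=> y _; rewrite derive1E /f.
      have dy : is_derive y 1 (fun y : R => y - sin y) (1 - cos y).
        by apply: is_derive_eq.
      by have [_ ->] := dy; rewrite subr_ge0 cos_le1.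
    - apply: continuous_subspaceT; apply: derivable_continuous => y.
      by rewrite /f; exact: ex_derive.
  by rewrite /f; lra.
apply: (le_trans (ler_normD _ _)); apply: lerD.
  have -> : expR (- (pi / 2 * tau)) * h =
    expR (- (pi / 2 * tau)) * expR 0 * (pi / 2 + h - pi / 2) by rewrite expR0; ring.
  apply: ler_norm_Rintegral_cst => // th /andP[th1 th2]; apply: bnd'.
  rewrite oppr0 mulr_ge0 ?(ltW tau0)// subr_ge0 sin_le//; lra.
pose k := tau * (1 - cos h); have k0 : 0 < k by rewrite mulr_gt0.
pose F (th : R) := - (expR (- (pi / 2 * tau)) / k * expR (- (k * (th - pi / 2 - h)))).
have dF (th : R) : is_derive th (1 : R) F
    (expR (- (pi / 2 * tau)) * expR (- (k * (th - pi / 2 - h)))).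
  by rewrite /F; apply: is_derive_eq; rewrite /GRing.scale/=; field; lra.
have cf : continuous (fun th : R => expR (- (pi / 2 * tau)) * expR (- (k * (th - pi / 2 - h)))).
  by apply: derivable_continuous => th; exact: ex_derive.
apply: (@le_trans _ _ (\int[mu]_(th in `[pi / 2 + h, T])
    (expR (- (pi / 2 * tau)) * expR (- (k * (th - pi / 2 - h)))))).
  apply: ler_norm_Rintegral => // th /andP[th1 _]; apply: bnd'; rewrite opprK.
  have s0 : 0 <= th - pi / 2 - h by lra.
  have hb : 0 <= h <= pi / 2 by rewrite (ltW h0).
  have := sin_tangent hb s0; have := sin_le (ltW h0).
  have -> : h + (th - pi / 2 - h) = th - pi / 2 by ring.
  by rewrite /k -mulrA => *; rewrite ler_wpM2l ?(ltW tau0)//; lra.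
rewrite (Rintegral_FTC hT cf dF) /F.
have -> : k * (pi / 2 + h - pi / 2 - h) = 0 by ring.
rewrite oppr0 expR0 -/k.
have : 0 <= expR (- (pi / 2 * tau)) / k * expR (- (k * (T - pi / 2 - h))).
  by rewrite mulr_ge0 ?expR_ge0// divr_ge0 ?expR_ge0// ltW.
by lra.
Qed.

Lemma horizontal_integral_le x tau t0 e T :
  0 < tau -> 0 <= t0 <= T -> tau <= x * cosh t0 -> 0 < e < pi / 2 ->
  `|\int[mu]_(t in `[t0, T]) contour_re x tau t (pi / 2 - e)| <=
  expR (- (pi / 2 * tau)) *
  (expR (tau * (e - sin e)) * Num.sqrt (pi / (2 * tau * sin e))).
Proof.
move=> tau0 /andP[t00 t0T] xt0 epi.
have se : 0 < sin e by apply: sin_gt0_pihalf.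
have q0 : 0 < tau * sin e / 2 by rewrite divr_gt0// mulr_gt0.
pose c := Num.sqrt (tau * sin e / 2); have c0 : 0 < c by rewrite sqrtr_gt0.
pose C := expR (- (pi / 2 * tau)) * expR (tau * (e - sin e)).
have cg : continuous (fun t : R => gauss_fun (c * (t - t0))).
  by rewrite /gauss_fun; apply: derivable_continuous => t; exact: ex_derive.
have cCg : continuous (fun t : R => C * gauss_fun (c * (t - t0))).
  by rewrite /gauss_fun; apply: derivable_continuous => t; exact: ex_derive.
apply: (@le_trans _ _ (\int[mu]_(t in `[t0, T]) (C * gauss_fun (c * (t - t0))))).
  apply: ler_norm_Rintegral => //; first exact: continuous_contour_rel.
  move=> t /andP[t1 _]; apply: (le_trans (norm_contour_re _ _ _ _)).
  by apply: contour_modulus_horizontal => //; rewrite t00.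
rewrite RintegralZl//; last exact: continuous_integrable_itv.
rewrite mulrA -/C ler_wpM2l ?mulr_ge0 ?expR_ge0//.
apply: (le_trans (Rintegral_itv_gauss_le c0 t0T)).
rewrite le_eqVlt; apply/orP; left; apply/eqP.
have -> : 2 * tau * sin e = (2 * c) ^+ 2 by rewrite exprMn sqr_sqrtr; [field|exact: ltW].
rewrite sqrtrM ?pi_ge0// sqrtrV ?sqr_ge0// sqrtr_sqr ger0_norm//.
by rewrite mulr_ge0// ltW.
Qed.

Lemma macdonaldK_le x tau e h :
  0 < x -> 0 < tau -> 0 < e < pi / 2 -> 0 < h <= pi / 2 ->
  `|macdonaldK tau x| <= expR (- (pi / 2 * tau)) *
  (expR (tau * (e - sin e)) * (e + Num.sqrt (pi / (2 * tau * sin e)))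
   + h + (tau * (1 - cos h))^-1).
Proof.
move=> x0 tau0 epi hpi.
(* For [x <= tau] the equation x cosh t0 = tau is solvable; otherwise t0 = 0 still gives the
   inequality wanted on the horizontal part. *)
have [t0 [t00 xt0 t0E]] : exists t0, [/\ 0 <= t0, tau <= x * cosh t0 &
    x * cosh t0 = tau \/ t0 = 0].
  have [xtau|taux] := leP x tau.
    have [t t0 tE] : exists2 t, 0 <= t & cosh t = tau / x.
      by apply: cosh_surj; rewrite ler_pdivlMr// mul1r.
    have E : x * cosh t = tau by rewrite tE; field; lra.
    by exists t; split => //; [rewrite E|left].
  exists 0; split; [by []| |by right].
  by rewrite /cosh oppr0 expR0; lra.
have /andP[e0 epi2] := epi; have /andP[h0 hpi2] := hpi.
have se : 0 < sin e by apply: sin_gt0_pihalf.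
have p0 := pi_gt0 R; have tau0' := ltW tau0; have x0' := ltW x0.
pose th0 : R := pi / 2 - e.
(* The three summands come from the truncated tail, the top side and the right side; each
   contributes a multiple of 1 / T. *)
pose M := (x ^+ 2)^-1 + t0 * expR (x * cosh t0) / tau + th0 / (x * sin e).
have M0 : 0 <= M.
  rewrite /M; apply: addr_ge0; first apply: addr_ge0.
  - by rewrite invr_ge0 sqr_ge0.
  - by rewrite divr_ge0// mulr_ge0// expR_ge0.
  - by rewrite divr_ge0 ?mulr_ge0 ?ltW// /th0; lra.
(* [T] will serve both as right end and as top height; the threshold ensures t0 <= T and pi/2 + h <=
   T. *)
apply: (@le_of_le_addM_inv _ _ _ M (t0 + pi)); [by []|lra|move=> T TT].
have T0 : 0 < T by lra.
apply: (le_trans (macdonaldK_truncation tau x0 T0)).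
rewrite (@contour_deformation _ x tau t0 T th0 T)//; last 2 first.
- by rewrite t00; lra.
- by rewrite /th0; apply/andP; split; lra.
have B1 : `|\int[mu]_(t in `[0, t0]) contour_re x tau t T| <=
    t0 * expR (x * cosh t0) / tau / T.
  have bnd : t0 * expR (x * cosh t0) / tau / T =
      expR (x * cosh t0) * (tau * T)^-1 * (t0 - 0) by field; lra.
  rewrite bnd; apply: ler_norm_Rintegral_cst => //.
    exact: continuous_contour_rel.
  move=> t /andP[t1 t2]; apply: (le_trans (norm_contour_re _ _ _ _)).
  rewrite /contour_modulus expRD ler_pM ?expR_ge0//; last first.
    by apply: expRN_le_inv; rewrite mulr_gt0.
  rewrite ler_expR -mulrN -mulrA ler_wpM2l//.
  have c0 := cosh_ge0 t.
  have : cosh t <= cosh t0.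
    rewrite -[in leRHS](subrKC t t0).
    have tt : 0 <= t0 - t by lra.
    apply: le_trans (cosh_shift_ge t1 tt); rewrite ler_peMr//.
    by have := sqr_ge0 (t0 - t); lra.
  by apply: le_trans; have := cos_geN1 T; nra.
have B2 : `|\int[mu]_(s in `[0, th0]) contour_im x tau T s| <= th0 / (x * sin e) / T.
  have bnd : th0 / (x * sin e) / T = (x * sin e * T)^-1 * (th0 - 0) by field; lra.
  rewrite bnd; apply: ler_norm_Rintegral_cst; first by rewrite /th0; lra.
    exact: continuous_contour_imr.
  move=> s /andP[s1 s2]; apply: (le_trans (norm_contour_im _ _ _ _)).
  apply: (le_trans _ (expRN_le_inv _)); last by rewrite !mulr_gt0.
  rewrite /contour_modulus ler_expR.
  have cs : sin e <= cos s.
    have -> : sin e = cos th0 by rewrite /th0 cosB cos_pihalf sin_pihalf; ring.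
    have [->//|sth] := eqVneq s th0; apply/ltW.
    have s2' : s <= pi / 2 - e := s2.
    rewrite ltr_cos ?in_itv/=; first by rewrite lt_neqAle sth.
      by apply/andP; split; lra.
    by rewrite /th0; apply/andP; split; lra.
  have := ler_pM (ltW se) (ltW T0) cs (cosh_ge (ltW T0)).
  move=> /(ler_wpM2l x0'); have := mulr_ge0 tau0' s1; lra.
have B3 : `|\int[mu]_(t in `[t0, T]) contour_re x tau t th0| <=
    expR (- (pi / 2 * tau)) *
    (expR (tau * (e - sin e)) * Num.sqrt (pi / (2 * tau * sin e))).
  by apply: horizontal_integral_le => //; rewrite t00; lra.
have B4 : `|\int[mu]_(s in `[th0, T]) contour_im x tau t0 s| <=
    expR (- (pi / 2 * tau)) *
    (expR (tau * (e - sin e)) * e + h + (tau * (1 - cos h))^-1).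
  by apply: vertical_integral_le => //; lra.
have tri (p q P Q : R) : `|p| <= P -> `|q| <= Q -> `|p + q| <= P + Q.
  by move=> pP qQ; apply: (le_trans (ler_normD _ _)); exact: lerD.
apply: (le_trans (lerD (tri _ _ _ _ (tri _ _ _ _ (tri _ _ _ _ B1 B3) B4) B2) (lexx _))).
by rewrite le_eqVlt; apply/orP; left; apply/eqP; rewrite /M; ring.
Qed.

End MacdonaldBound.

(** * Numerical choice of the parameters, by ranges of [tau] *)

Section MacdonaldSquareBound.
Context {R : realType}.
Implicit Types (e h r x tau : R).

Lemma oneB_expRN_le1 x : 1 - expR (- x) <= 1.
Proof. by have := expR_ge0 (- x); lra. Qed.

(** Squaring exp(- x) >= 1 - x >= 0 retains a second-order gain, which is used for small [tau]. *)
Lemma oneB_expRN_le x : x <= 1 -> 1 - expR (- (2 * x)) <= 2 * x - x ^+ 2.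
Proof.
move=> x1; have -> : - (2 * x) = - x + - x by ring.
by rewrite expRD; have := expR_ge1Dx (- x); nra.
Qed.

(** The squared factor exp(- pi tau) cancels the growth of [sinh]: their product is (1 - exp(- 2 pi
    tau)) / 2. *)
Lemma sinh_macdonaldK_sqr_le x tau (C : R) : 0 < tau ->
  `|macdonaldK tau x| <= expR (- (pi / 2 * tau)) * C ->
  tau * sinh (pi * tau) * macdonaldK tau x ^+ 2 <=
  tau * C ^+ 2 * ((1 - expR (- (2 * (pi * tau)))) / 2).
Proof.
move=> tau0 KC; have pt0 : 0 <= pi * tau by rewrite mulr_ge0 ?pi_ge0// ltW.
have s0 : 0 <= sinh (pi * tau) by apply: (le_trans pt0); exact: sinh_ge.
have K2 : macdonaldK tau x ^+ 2 <= (expR (- (pi / 2 * tau)) * C) ^+ 2.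
  by rewrite -real_normK ?num_real// ler_pXn2r ?nnegrE//; apply: le_trans KC.
apply: (le_trans (ler_wpM2l (mulr_ge0 (ltW tau0) s0) K2)).
rewrite le_eqVlt; apply/orP; left; apply/eqP.
have -> : (expR (- (pi / 2 * tau)) * C) ^+ 2 = expR (- (pi * tau)) * C ^+ 2.
  by rewrite exprMn -expRM_natl; congr (expR _ * _); field.
have -> : - (2 * (pi * tau)) = - (pi * tau) + - (pi * tau) by ring.
rewrite expRD /sinh; have := expRxMexpNx_1 (pi * tau).
set P := expR (pi * tau); set N := expR _ => PN.
by transitivity (tau * C ^+ 2 * ((P * N - N * N) / 2)); [field|rewrite PN].
Qed.

Lemma sin_3div4_ge : 87 / 128 <= sin (3 / 4) :> R.
Proof. by have h : 0 <= 3 / 4 :> R by []; have := sin_ge3 h; lra. Qed.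

(** The choice is e = 3/4 and h = pi/2. Since e - sin e <= 9/128, the exponential factor is at most
    1 / (1 - 9/128) = 128/119; [Y / r] bounds the square root, with 64/87 from [sin_3div4_ge]. *)
Lemma macdonaldK_le_tau1 x tau r : 0 < x -> 0 < r -> r ^+ 2 = tau -> tau <= 1 ->
  exists C : R, [/\ `|macdonaldK tau x| <= expR (- (pi / 2 * tau)) * C, 0 <= C &
    exists Y : R, [/\ C = 128 / 119 * (3 / 4 + Y / r) + pi / 2 + tau^-1,
      0 <= Y & Y ^+ 2 = pi * (64 / 87)]].
Proof.
move=> x0 r0 rtau tau1; have p3 := pi_ge3 (R := R).
have tau0 : 0 < tau by rewrite -rtau exprn_gt0.
have sg := sin_3div4_ge.
pose Y : R := Num.sqrt (pi * (64 / 87)).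
have Y0 : 0 <= Y by exact: sqrtr_ge0.
have Y2 : Y ^+ 2 = pi * (64 / 87) by rewrite sqr_sqrtr//; lra.
exists (128 / 119 * (3 / 4 + Y / r) + pi / 2 + tau^-1); split; last by exists Y; split.
  have epi : 0 < (3 / 4 : R) < pi / 2.
    by apply/andP; split; lra.
  have hpi : 0 < (pi / 2 : R) <= pi / 2 by apply/andP; split; lra.
  apply: (le_trans (macdonaldK_le x0 tau0 epi hpi)).
  rewrite ler_wpM2l ?expR_ge0// cos_pihalf subr0 mulr1 !lerD2r.
  apply: ler_pM; [exact: expR_ge0| |  | ].
  - by rewrite addr_ge0 ?sqrtr_ge0//; lra.
  - have b : tau * (3 / 4 - sin (3 / 4)) <= 9 / 128.
      have s1 : 3 / 4 - sin (3 / 4) <= 9 / 128 :> R by lra.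
      apply: (le_trans (ler_wpM2l (ltW tau0) s1)).
      by rewrite ler_piMl//; lra.
    apply: (le_trans (_ : _ <= expR (9 / 128))); first by rewrite ler_expR.
    have -> : 128 / 119 = (1 - 9 / 128)^-1 :> R by field.
    by apply: expR_le_inv; lra.
  - rewrite lerD2l -[leRHS]ger0_norm; last by rewrite divr_ge0// ltW.
    rewrite -sqrtr_sqr ler_wsqrtr// expr_div_n Y2 rtau.
    rewrite ler_pdivrMr; last by rewrite !mulr_gt0//; lra.
    have -> : pi * (64 / 87) / tau * (2 * tau * sin (3 / 4)) =
      pi * (128 / 87 * sin (3 / 4)) by field; lra.
    by rewrite ler_peMr//; lra.
have Yr0 : 0 <= Y / r by rewrite divr_ge0// ltW.
have ti0 : 0 <= tau^-1 by rewrite invr_ge0 ltW.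
by lra.
Qed.

(** Here [C] grows like 1 / tau, so tau C^2 = (tau C)^2 / tau, and the remaining 1 / tau is
    compensated by 1 - exp(- 2 pi tau). *)
Lemma sinh_macdonaldK_sqr_small x tau : 0 < x -> 0 < tau -> tau <= 1 / 5 ->
  tau * sinh (pi * tau) * macdonaldK tau x ^+ 2 <= pi * (19 / 5).
Proof.
move=> x0 tau0 tau5; have p3 := pi_ge3 (R := R); have p32 := pi_le (R := R).
pose r := Num.sqrt tau; have r0 : 0 < r by rewrite sqrtr_gt0.
have rtau : r ^+ 2 = tau by rewrite sqr_sqrtr// ltW.
have tau1 : tau <= 1 by lra.
have [C [KC C0 [Y [CE Y0 Y2]]]] := macdonaldK_le_tau1 x0 r0 rtau tau1.
apply: (le_trans (sinh_macdonaldK_sqr_le tau0 KC)).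
have pt1 : pi * tau <= 1.
  by have := ler_pM (pi_ge0 R) (ltW tau0) p32 tau5; lra.
have := oneB_expRN_le pt1; set N := 1 - _ => NE.
have Y1 : Y <= 154 / 100.
  by apply: ler_of_sqr; lra.
have Crt : tau * C = 1 + 128 / 119 * (Y * r) + (128 / 119 * (3 / 4) + pi / 2) * r ^+ 2.
  by rewrite CE -rtau; field; lra.
have r5 : r <= 9 / 20.
  by apply: ler_of_sqr; lra.
have Yr : Y * r <= 154 / 100 * r by rewrite ler_pM2r.
have pr2 : pi * r ^+ 2 <= 16 / 5 * r ^+ 2 by rewrite ler_wpM2r// sqr_ge0.
have Ct : tau * C <= 1 + 28 / 10 * r.
  have r2 : r ^+ 2 <= 9 / 20 * r by rewrite expr2 ler_pM2r.
  by rewrite Crt; lra.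
have tC0 : 0 <= tau * C by rewrite mulr_ge0// ltW.
have -> : tau * C ^+ 2 * (N / 2) = (tau * C) ^+ 2 * (N / 2 / tau) by field; lra.
(* From pi (1 - pi tau / 2) with pi >= 3, enlarged to a perfect square so that its root can be
   multiplied with [tau * C]. *)
have NT : N / 2 / tau <= pi * (1 - 3 / 4 * r ^+ 2) ^+ 2.
  rewrite ler_pdivrMr// rtau.
  have := mulr_ge0 (pi_ge0 R) (sqr_ge0 tau).
  have : 0 <= pi * tau * (tau * (pi - 3)) by rewrite !mulr_ge0 ?pi_ge0 ?subr_ge0// ltW.
  have : 0 <= pi * tau * tau ^+ 2 by rewrite !mulr_ge0 ?pi_ge0 ?sqr_ge0// ltW.
  by move: NE; rewrite !expr2; lra.
have N0 : 0 <= N / 2 / tau.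
  have N0 : 0 <= N by rewrite subr_ge0 expR_le1 oppr_le0 !mulr_ge0 ?pi_ge0// ltW.
  by rewrite divr_ge0 ?(ltW tau0)// divr_ge0.
apply: (le_trans (ler_wpM2l (sqr_ge0 _) NT)).
have -> : (tau * C) ^+ 2 * (pi * (1 - 3 / 4 * r ^+ 2) ^+ 2) =
  pi * (tau * C * (1 - 3 / 4 * r ^+ 2)) ^+ 2 by ring.
rewrite ler_wpM2l ?pi_ge0//.
have b0 : 0 <= 1 - 3 / 4 * r ^+ 2 by rewrite rtau; lra.
have b1 : tau * C * (1 - 3 / 4 * r ^+ 2) <= 194 / 100.
  by apply: (le_trans (ler_wpM2r b0 Ct)); nra.
have b2 : 0 <= tau * C * (1 - 3 / 4 * r ^+ 2) by rewrite mulr_ge0.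
have : (tau * C * (1 - 3 / 4 * r ^+ 2)) ^+ 2 <= (194 / 100) ^+ 2.
  exact: ler_sqr_nneg.
by lra.
Qed.

(** Away from 0, 1 - exp(- 2 pi tau) is simply bounded by 1; measuring sqrt(tau) C in units of
    sqrt(2 pi) makes the result pi c^2. *)
Lemma sinh_macdonaldK_sqr_le_half x tau (C p c : R) : 0 < tau ->
  `|macdonaldK tau x| <= expR (- (pi / 2 * tau)) * C ->
  tau * C ^+ 2 <= (c * p) ^+ 2 -> p ^+ 2 = 2 * pi ->
  tau * sinh (pi * tau) * macdonaldK tau x ^+ 2 <= pi * c ^+ 2.
Proof.
move=> tau0 KC Ccp p2; apply: (le_trans (sinh_macdonaldK_sqr_le tau0 KC)).
have C0 : 0 <= tau * C ^+ 2 by rewrite mulr_ge0 ?sqr_ge0// ltW.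
have h1 : (1 - expR (- (2 * (pi * tau)))) / 2 <= 1 / 2.
  by have := oneB_expRN_le1 (2 * (pi * tau)); lra.
apply: (le_trans (ler_wpM2l C0 h1)).
by move: Ccp; rewrite exprMn p2; lra.
Qed.

Lemma sinh_macdonaldK_sqr_mid x tau : 0 < x -> 1 / 5 <= tau <= 1 ->
  tau * sinh (pi * tau) * macdonaldK tau x ^+ 2 <= pi * (43 / 10).
Proof.
move=> x0 /andP[tau5 tau1]; have tau0 : 0 < tau by lra.
have p3 := pi_ge3 (R := R); have p32 := pi_le (R := R).
pose r := Num.sqrt tau; have r0 : 0 < r by rewrite sqrtr_gt0.
have rtau : r ^+ 2 = tau by rewrite sqr_sqrtr// ltW.
have [C [KC C0 [Y [CE Y0 Y2]]]] := macdonaldK_le_tau1 x0 r0 rtau tau1.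
pose p : R := Num.sqrt (2 * pi); have p0 : 0 <= p := sqrtr_ge0 _.
have pp : p ^+ 2 = 2 * pi by rewrite sqr_sqrtr//; lra.
have p24 : 244 / 100 <= p.
  by apply: ler_of_sqr; lra.
have Yp : Y <= 61 / 100 * p.
  by apply: ler_of_sqr; rewrite ?exprMn ?pp ?Y2; lra.
have r1 : r <= 1 by apply: ler_of_sqr; lra.
have r44 : 44 / 100 <= r by apply: ler_of_sqr; lra.
have rC : r * C = r^-1 + (128 / 119 * (3 / 4) + pi / 2) * r + 128 / 119 * Y.
  by rewrite CE -rtau; field; lra.
(* A convex function of [r], hence controlled by its values at 44/100 and 1. *)
have A1 : r^-1 + (128 / 119 * (3 / 4) + pi / 2) * r <= 342 / 100.
  have pr : pi * r <= 16 / 5 * r by rewrite ler_wpM2r// ltW.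
  suff : r^-1 + 241 / 100 * r <= 342 / 100 by lra.
  rewrite -(ler_pM2r r0) mulrDl mulVf ?lt0r_neq0//.
  by nra.
apply: (le_trans (@sinh_macdonaldK_sqr_le_half x tau C p (207 / 100) tau0 KC _ pp)).
  have -> : tau * C ^+ 2 = (r * C) ^+ 2 by rewrite exprMn rtau.
  have rCp : r * C <= 207 / 100 * p by rewrite rC; lra.
  by apply: ler_sqr_nneg; rewrite ?mulr_ge0 ?(ltW r0).
rewrite ler_wpM2l ?pi_ge0//; lra.
Qed.

Lemma sinh_macdonaldK_sqr_large x tau : 0 < x -> 1 <= tau ->
  tau * sinh (pi * tau) * macdonaldK tau x ^+ 2 <= pi * (1 + 4 * Num.sqrt tau).
Proof.
move=> x0 tau1; have tau0 : 0 < tau by lra.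
have p3 := pi_ge3 (R := R).
pose g := Num.sqrt (Num.sqrt tau).
have g2 : g ^+ 2 = Num.sqrt tau by rewrite sqr_sqrtr ?sqrtr_ge0.
have g4 : tau = g ^+ 4.
  by rewrite -[RHS]/(g ^+ (2 * 2)) exprM g2 sqr_sqrtr// ltW.
have g0 : 0 <= g by exact: sqrtr_ge0.
have g1 : 1 <= g.
  rewrite leNgt; apply/negP => g1.
  by have : g ^+ 4 < 1 ^+ 4 by [rewrite ltr_pXn2r ?nnegrE]; rewrite expr1n -g4; lra.
have gg0 : 0 < g by lra.
rewrite -g2; pose w := g^-1; have w0 : 0 < w by rewrite invr_gt0.
have w1 : w <= 1 by rewrite invf_le1.
have wg : w * g = 1 by rewrite mulVf// lt0r_neq0.
have w2 : w ^+ 2 <= 1 by rewrite expr_le1// ltW.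
(* With w = tau^(-1/4), tau (e - sin e) stays bounded, while [h], the Gaussian width and hence
   sqrt-term are all of order [w]. *)
pose e := w ^+ 2 / 2; pose h := 6 / 5 * w.
have e0 : 0 < e by rewrite divr_gt0// exprn_gt0.
have e12 : e <= 1 / 2 by rewrite /e; lra.
have tauw : tau * w ^+ 4 = 1 by rewrite g4 -exprMn mulrC wg expr1n.
have se : 23 / 24 * e <= sin e.
  have := sin_ge3 (ltW e0).
  have : 0 <= e * (1 / 4 - e ^+ 2) by rewrite mulr_ge0 ?(ltW e0)//; nra.
  by rewrite !exprS expr0; lra.
have ee : tau * (e - sin e) <= 1 / 48.
  have s1 : e - sin e <= w ^+ 4 / 48.
    have := sin_ge3 (ltW e0); have -> : e ^+ 3 / 6 = w ^+ 4 / 48 * w ^+ 2 by rewrite /e; field.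
    have := ler_piMr (_ : 0 <= w ^+ 4 / 48) w2.
    by rewrite divr_ge0 ?exprn_ge0 ?(ltW w0)// => /(_ isT); lra.
  apply: (le_trans (ler_wpM2l (ltW tau0) s1)).
  by rewrite mulrA tauw.
have epi : 0 < e < pi / 2 by rewrite e0/=; lra.
have hpi : 0 < h <= pi / 2 by rewrite /h; apply/andP; split; lra.
have ch : 63 / 100 * w ^+ 2 <= 1 - cos h.
  have h0 : 0 <= h by rewrite /h; lra.
  have := cos_le4 h0.
  have -> : h ^+ 2 = 36 / 25 * w ^+ 2 by rewrite /h; field.
  have -> : h ^+ 4 = 54 / 25 * (24 / 25) * w ^+ 4 by rewrite /h; field.
  have : w ^+ 4 <= w ^+ 2 by rewrite -[leLHS]/(w ^+ (2 * 2)) exprM expr2 ler_piMr// sqr_ge0.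
  by have := sqr_ge0 w; lra.
have KC := macdonaldK_le x0 tau0 epi hpi.
set C := (X in _ * X) in KC.
pose p : R := Num.sqrt (2 * pi); have p0 : 0 <= p := sqrtr_ge0 _.
have pp : p ^+ 2 = 2 * pi by rewrite sqr_sqrtr//; lra.
have p24 : 244 / 100 <= p.
  by apply: ler_of_sqr; lra.
have sq : Num.sqrt (pi / (2 * tau * sin e)) <= 73 / 100 * p * w.
  have pw0 : 0 <= 73 / 100 * p * w by rewrite !mulr_ge0 ?(ltW w0)//; lra.
  rewrite -[leRHS]ger0_norm// -sqrtr_sqr ler_wsqrtr//.
  have d0 : 0 < 2 * tau * sin e by rewrite !mulr_gt0//; lra.
  rewrite ler_pdivrMr//.
  have -> : (73 / 100 * p * w) ^+ 2 * (2 * tau * sin e) =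
    p ^+ 2 * ((73 / 100) ^+ 2 * 2 * (tau * w ^+ 2 * sin e)) by ring.
  have -> : p ^+ 2 * ((73 / 100) ^+ 2 * 2 * (tau * w ^+ 2 * sin e)) =
    pi * ((73 / 100) ^+ 2 * 4 * (tau * w ^+ 2 * sin e)) by rewrite pp; ring.
  rewrite ler_peMr ?pi_ge0//.
  have : tau * w ^+ 2 * (23 / 24 * e) <= tau * w ^+ 2 * sin e.
    by rewrite ler_wpM2l// mulr_ge0 ?sqr_ge0// ltW.
  have -> : tau * w ^+ 2 * (23 / 24 * e) = 23 / 48 * (tau * w ^+ 4) by rewrite /e; field.
  by rewrite tauw; lra.
have E1 : expR (tau * (e - sin e)) <= 48 / 47.
  apply: (le_trans (_ : _ <= expR (1 / 48))); first by rewrite ler_expR.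
  have -> : 48 / 47 = (1 - 1 / 48)^-1 :> R by field.
  by apply: expR_le_inv; lra.
have iv : (tau * (1 - cos h))^-1 <= 100 / 63 * w ^+ 2.
  have c0 : 0 < tau * (63 / 100 * w ^+ 2) by rewrite !mulr_gt0 ?exprn_gt0//; lra.
  apply: (@le_trans _ _ (tau * (63 / 100 * w ^+ 2))^-1).
    have cc : tau * (63 / 100 * w ^+ 2) <= tau * (1 - cos h).
      by rewrite ler_wpM2l// ltW.
    by rewrite lef_pV2 ?posrE//; apply: lt_le_trans cc.
  rewrite -[leLHS]mul1r ler_pdivrMr//.
  have -> : 100 / 63 * w ^+ 2 * (tau * (63 / 100 * w ^+ 2)) = tau * w ^+ 4 by field.
  by rewrite tauw.
have CB : C <= 48 / 47 * (e + 73 / 100 * p * w) + h + 100 / 63 * w ^+ 2.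
  rewrite /C; apply: lerD => //; apply: lerD => //.
  apply: ler_pM; [exact: expR_ge0| |exact: E1|by rewrite lerD2l].
  by rewrite addr_ge0 ?sqrtr_ge0// ltW.
have C0 : 0 <= C.
  have ti0 : 0 <= (tau * (1 - cos h))^-1.
    by rewrite invr_ge0 mulr_ge0 ?(ltW tau0)//; have := sqr_ge0 w; lra.
  have E0 : 0 <= expR (tau * (e - sin e)) * (e + Num.sqrt (pi / (2 * tau * sin e))).
    by rewrite mulr_ge0 ?expR_ge0// addr_ge0 ?sqrtr_ge0// ltW.
  by rewrite /C addr_ge0// addr_ge0// /h; lra.
(* Rounded coefficients of the bound for g^2 C, divided by p >= 244/100 where needed; for g >= 1,
   c^2 <= 1 + 4 g^2. *)
pose c := 124 / 100 * g + 86 / 100.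
have Cc : tau * C ^+ 2 <= (c * p) ^+ 2.
  have -> : tau * C ^+ 2 = (g ^+ 2 * C) ^+ 2 by rewrite exprMn -exprM g4.
  have g20 : 0 <= g ^+ 2 by exact: sqr_ge0.
  have gC := ler_wpM2l g20 CB.
  have w2E : g ^+ 2 * w ^+ 2 = 1 by rewrite -exprMn mulrC wg expr1n.
  have gE : g ^+ 2 * (48 / 47 * (e + 73 / 100 * p * w) + h + 100 / 63 * w ^+ 2) =
      (24 / 47 + 100 / 63) * (g ^+ 2 * w ^+ 2)
      + (48 / 47 * (73 / 100) * p + 6 / 5) * (g * (w * g)).
    by rewrite /e /h; field.
  rewrite gE w2E wg !mulr1 in gC.
  have gp : g * (244 / 100) <= g * p by rewrite ler_wpM2l.
  apply: ler_sqr_nneg; first by rewrite mulr_ge0.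
  by apply: (le_trans gC); rewrite /c; lra.
apply: (le_trans (sinh_macdonaldK_sqr_le_half tau0 KC Cc pp)).
by rewrite ler_wpM2l ?pi_ge0// /c; nra.
Qed.

Lemma sinh_macdonaldK_sqr x tau : 0 < x -> 0 < tau ->
  tau * sinh (pi * tau) * macdonaldK tau x ^+ 2 <=
  pi * (1 + 4 * Num.sqrt (tau + 1 / 2)).
Proof.
move=> x0 tau0; pose q := Num.sqrt (tau + 1 / 2).
have q0 : 0 <= q by exact: sqrtr_ge0.
have q2 : q ^+ 2 = tau + 1 / 2 by rewrite sqr_sqrtr//; lra.
have [tau5|tau5] := leP tau (1 / 5).
  apply: (le_trans (sinh_macdonaldK_sqr_small x0 tau0 tau5)).
  rewrite ler_wpM2l ?pi_ge0// -/q.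
  (* The target of this range was 19/5 = 1 + 4 (7/10), as q^2 >= 1/2; the next one is 43/10 = 1 + 4
     (33/40), as q^2 >= 7/10. *)
  have : 7 / 10 <= q by apply: ler_of_sqr; lra.
  by lra.
have [tau1|tau1] := leP tau 1.
  have tau51 : 1 / 5 <= tau <= 1 by rewrite (ltW tau5).
  apply: (le_trans (sinh_macdonaldK_sqr_mid x0 tau51)).
  rewrite ler_wpM2l ?pi_ge0// -/q.
  have : 33 / 40 <= q by apply: ler_of_sqr; lra.
  by lra.
apply: (le_trans (sinh_macdonaldK_sqr_large x0 (ltW tau1))).
rewrite ler_wpM2l ?pi_ge0// lerD2l ler_pM2l// ler_wsqrtr//.
by lra.
Qed.

End MacdonaldSquareBound.

(** * Values and bounds of the gamma function at 1/2, 5/2 and 3 *)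

Section GammaValues.
Context {R : realType}.
Implicit Types (a b c t z w : R).

Local Notation mu := (@lebesgue_measure R).

Lemma Gamma_ge0 z : 0 <= Gamma z.
Proof. by apply: Rintegral_ge0 => t _; rewrite mulr_ge0 ?powR_ge0 ?expR_ge0. Qed.

Lemma Beta_ge0 z w : 0 <= Beta z w.
Proof. by rewrite divr_ge0 ?mulr_ge0 ?Gamma_ge0. Qed.

Lemma cvg_poly2_expRN a b c :
  (a * t ^+ 2 + b * t + c) * expR (- t) @[t --> +oo] --> (0 : R).
Proof.
pose K := 6 * (`|a| + `|b| + `|c|).
have K0 : 0 <= K by rewrite mulr_ge0// !addr_ge0.
apply/cvgr0Pnorm_le => e e0; near=> t.
have t1 : 1 <= t by near: t; apply: nbhs_pinfty_ge; exact: num_real.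
have tK : K / e <= t by near: t; apply: nbhs_pinfty_ge; exact: num_real.
have t0 : 0 < t by lra.
have E : expR (- t) <= 6 / t ^+ 3.
  rewrite expRN -[leRHS]invf_div lef_pV2 ?posrE ?expR_gt0 ?divr_gt0 ?exprn_gt0//.
  by have := @expR_ge1Dxn R t 2 (ltW t0); rewrite (_ : 3`!%:R = 6)//; lra.
have P : `|a * t ^+ 2 + b * t + c| <= (`|a| + `|b| + `|c|) * t ^+ 2.
  apply: (le_trans (ler_normD _ _)); rewrite [leRHS]mulrDl; apply: lerD; last first.
    by rewrite ler_peMr//; nra.
  apply: (le_trans (ler_normD _ _)); rewrite [leRHS]mulrDl; apply: lerD.
    by rewrite normrM (ger0_norm (sqr_ge0 t)).
  by rewrite normrM (ger0_norm (ltW t0)) ler_wpM2l//; nra.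
rewrite normrM (ger0_norm (expR_ge0 _)).
apply: (le_trans (ler_pM _ _ P E)) => //.
have -> : (`|a| + `|b| + `|c|) * t ^+ 2 * (6 / t ^+ 3) = K / t by rewrite /K; field; lra.
by rewrite ler_pdivrMr// mulrC -ler_pdivrMr.
Unshelve. all: by end_near. Qed.

(** Parametrised by the coefficients of the primitive - (a t^2 + b t + c) exp(- t), so that the
    integral is read off at 0. *)
Lemma integral_poly2_expRN a b c :
  (forall t, 0 <= t -> 0 <= a * t ^+ 2 + (b - 2 * a) * t + (c - b)) ->
  (\int[mu]_(t in `[0%R, +oo[)
    ((a * t ^+ 2 + (b - 2 * a) * t + (c - b)) * expR (- t))%:E)%E = c%:E.
Proof.
move=> p0.
pose F (t : R) := - ((a * t ^+ 2 + b * t + c) * expR (- t)).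
have dF (t : R) : is_derive t (1 : R) F
    ((a * t ^+ 2 + (b - 2 * a) * t + (c - b)) * expR (- t)).
  by rewrite /F; apply: is_derive_eq; rewrite /GRing.scale/=; ring.
have cF : continuous F by apply: derivable_continuous => t; have [] := dF t.
rewrite (@ge0_continuous_FTC2y _ _ F 0 0).
- by rewrite -EFinB; congr (_%:E); rewrite /F oppr0 expR0; ring.
- by move=> t t0; rewrite mulr_ge0 ?expR_ge0// p0.
- apply: continuous_subspaceT; apply: derivable_continuous => t; exact: ex_derive.
- by rewrite -oppr0; apply: cvgN; exact: cvg_poly2_expRN.
- by move=> t _; have [] := dF t.
- exact/cvg_at_right_filter/cF.
- by move=> t _; rewrite derive1E; have [_] := dF t.
Qed.

Lemma measurable_powR_expRN z (D : set R) :
  measurable_fun D (fun t : R => (t `^ z * expR (- t))%:E).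
Proof.
apply/measurable_EFinP/measurable_funTS/measurable_funM; first exact: measurable_powR.
apply: continuous_measurable_fun; apply: derivable_continuous => t.
exact: ex_derive.
Qed.

Lemma GammaE z (f : R -> R) : (forall t, 0 < t -> t `^ (z - 1) = f t) ->
  measurable_fun setT f ->
  Gamma z = fine (\int[mu]_(t in `[0%R, +oo[) (f t * expR (- t))%:E)%E.
Proof.
move=> zf mf; rewrite /Gamma /Rintegral; congr fine.
rewrite -[RHS]integral_itv_obnd_cbnd.
  apply: eq_integral => t; rewrite inE /= in_itv /= andbT => t0.
  by rewrite zf.
apply/measurable_EFinP/measurable_funTS/measurable_funM => //.
apply: continuous_measurable_fun; apply: derivable_continuous => t.
exact: ex_derive.
Qed.

Lemma Gamma3 : Gamma 3 = 2 :> R.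
Proof.
rewrite (@GammaE _ (fun t => t ^+ 2)); last 2 first.
- by move=> t t0; rewrite (_ : 3 - 1 = 2%:R) ?powR_mulrn ?ltW//; ring.
- by apply: continuous_measurable_fun; apply: derivable_continuous => t; exact: ex_derive.
rewrite (_ : (fun _ => _) = (fun t : R =>
    ((1 * t ^+ 2 + (2 - 2 * 1) * t + (2 - 2)) * expR (- t))%:E)); last first.
  by apply/funext => t; congr (_%:E); ring.
by rewrite integral_poly2_expRN// => t _; have := sqr_ge0 t; lra.
Qed.

(** With s = sqrt t, the identity 2 s^3 - 3 s^2 + 1 = (s - 1)^2 (2 s + 1) gives t^(3/2) + 1/2 >= 3 t
    / 2; integrating against exp(- t) gives the bound. *)
Lemma Gamma52_ge1 : 1 <= Gamma (5 / 2) :> R.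
Proof.
have ms : measurable_fun setT (fun t : R => t * Num.sqrt t).
  apply: measurable_funM => //; apply: continuous_measurable_fun.
  exact: sqrt_continuous.
have me : measurable_fun setT (fun t : R => expR (- t)).
  by apply: continuous_measurable_fun; apply: derivable_continuous => t; exact: ex_derive.
rewrite (@GammaE _ (fun t => t * Num.sqrt t)) //; last first.
  move=> t t0; rewrite (_ : 5 / 2 - 1 = 1 + 2^-1); last by field.
  by rewrite powRD ?powRr1 ?powR12_sqrt ?ltW//; apply/implyP => _; rewrite lt0r_neq0.
set I := (\int[_]_(_ in _) _)%E.
have m1 (f : R -> R) (D : set R) : measurable_fun setT f ->
    measurable_fun D (fun t => (f t * expR (- t))%:E).
  by move=> mf; apply/measurable_EFinP/measurable_funTS/measurable_funM.
have I0 : (0 <= I)%E.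
  apply: integral_ge0 => t; rewrite /= in_itv /= andbT => t0.
  by rewrite lee_fin !mulr_ge0 ?expR_ge0.
(* This is for finiteness: [fine] would send an infinite integral to 0. The majorant of t^(3/2) is
   t^2 + 1. *)
have q1 : (I <= 3%:E)%E.
  have q (t : R) : 0 <= t -> 0 <= 1 * t ^+ 2 + (2 - 2 * 1) * t + (3 - 2).
    by move=> t0; have := sqr_ge0 t; lra.
  rewrite -(integral_poly2_expRN q); apply: ge0_le_integral => //.
  - by move=> t; rewrite /= in_itv /= andbT => t0; rewrite lee_fin !mulr_ge0 ?expR_ge0.
  - exact: m1.
  - apply: m1; apply: continuous_measurable_fun; apply: derivable_continuous => t.
    exact: ex_derive.
  - move=> t; rewrite /= in_itv /= andbT => t0; rewrite lee_fin ler_wpM2r ?expR_ge0//.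
    have := sqr_sqrtr t0; set s := Num.sqrt t => s2.
    by have s0 : 0 <= s := sqrtr_ge0 _; rewrite -s2; nra.
have If : I \is a fin_num by rewrite ge0_fin_numE// (le_lt_trans q1)// ltry.
have q32 (t : R) : 0 <= t -> 0 <= 0 * t ^+ 2 + (3 / 2 - 2 * 0) * t + (3 / 2 - 3 / 2).
  by move=> t0; lra.
have q12 (t : R) : 0 <= t -> 0 <= 0 * t ^+ 2 + (0 - 2 * 0) * t + (1 / 2 - 0).
  by move=> t0; lra.
have : ((3 / 2)%:E <= I + (1 / 2)%:E)%E.
  rewrite -(integral_poly2_expRN q32) -(integral_poly2_expRN q12).
  rewrite /I -ge0_integralD//.
  - apply: ge0_le_integral => //.
    + by move=> t; rewrite /= in_itv /= andbT => t0; rewrite lee_fin mulr_ge0 ?expR_ge0 ?q32.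
    + apply: m1; apply: continuous_measurable_fun; apply: derivable_continuous => t.
      exact: ex_derive.
    + apply: emeasurable_funD; first exact: m1.
      apply: m1; apply: continuous_measurable_fun; apply: derivable_continuous => t.
      exact: ex_derive.
    + move=> t; rewrite /= in_itv /= andbT => t0; rewrite -EFinD lee_fin -mulrDl.
      rewrite ler_wpM2r ?expR_ge0//.
      have := sqr_sqrtr t0; set s := Num.sqrt t => s2.
      have s0 : 0 <= s := sqrtr_ge0 _.
      have : 0 <= (s - 1) ^+ 2 * (2 * s + 1) by rewrite mulr_ge0 ?sqr_ge0//; lra.
      by rewrite -s2; lra.
  - by move=> t; rewrite /= in_itv /= andbT => t0; rewrite lee_fin !mulr_ge0 ?expR_ge0.
  - exact: m1.
  - by move=> t; rewrite /= in_itv /= andbT => t0; rewrite lee_fin mulr_ge0 ?expR_ge0 ?q12.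
  - apply: m1; apply: continuous_measurable_fun; apply: derivable_continuous => t.
    exact: ex_derive.
by rewrite -(fineK If) -EFinD lee_fin; lra.
Qed.

(** Squaring maps the segment of exponent 1 onto that of exponent 2, for the substitution in
    [Gamma_half]. *)
Definition pos_segment (k n : nat) : set R :=
  [set` `[(n.+1%:R ^+ k)^-1, n.+1%:R ^+ k]%R].

Lemma bigcup_pos_segment k : (0 < k)%N ->
  \bigcup_n pos_segment k n = [set` `]0, +oo[%R].
Proof.
move=> k0; have n1 (n : nat) : 1 <= n.+1%:R :> R by rewrite ler1n.
apply/seteqP; split => [t [n _]|t]; rewrite /= !in_itv /= ?andbT.
  move=> /andP[h _]; have h2 : 0 < (n.+1%:R ^+ k)^-1 :> R by rewrite invr_gt0 exprn_gt0.
  exact: (lt_le_trans h2 h).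
move=> t0; pose m := maxn (Num.trunc t) (Num.trunc t^-1).
have tm : t <= m.+1%:R.
  apply: (le_trans (ltW (truncnS_gt t))).
  by rewrite ler_nat ltnS leq_maxl.
have itm : t^-1 <= m.+1%:R.
  apply: (le_trans (ltW (truncnS_gt t^-1))).
  by rewrite ler_nat ltnS leq_maxr.
have mk : m.+1%:R <= m.+1%:R ^+ k :> R by rewrite ler_eXnr.
exists m => //; apply/andP; split; last exact: (le_trans tm mk).
change ((m.+1%:R ^+ k)^-1 <= t).
rewrite -[leRHS]invrK lef_pV2 ?posrE ?invr_gt0 ?exprn_gt0//.
exact: le_trans itm mk.
Qed.

Lemma nondecreasing_pos_segment k : nondecreasing_seq (pos_segment k).
Proof.
move=> m n mn; apply/subsetPset; apply: subset_itvScc; rewrite bnd_simp.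
  by rewrite lef_pV2 ?posrE ?exprn_gt0// lerXn2r ?nnegrE// ler_nat ltnS.
by rewrite lerXn2r ?nnegrE// ler_nat ltnS.
Qed.

Lemma cvg_integral_pos_segment k (f : R -> R) : (0 < k)%N ->
  (forall t, 0 <= f t) -> measurable_fun setT f ->
  (\int[mu]_(t in pos_segment k n) (f t)%:E)%E @[n --> \oo] -->
  (\int[mu]_(t in `]0%R, +oo[) (f t)%:E)%E.
Proof.
move=> k0 f0 mf; rewrite -(bigcup_pos_segment k0).
apply: ge0_nondecreasing_set_cvg_integral.
- exact: nondecreasing_pos_segment.
- by move=> n; exact: measurable_itv.
- by move=> n; apply/measurable_EFinP; apply: measurable_funTS.
- by move=> n t _; rewrite lee_fin.
Qed.

(** The substitution t = s^2 turns the integral into twice the half-line Gaussian. It is made on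
    compact segments avoiding the singularity at 0, followed by monotone convergence. *)
Lemma Gamma_half : Gamma (1 / 2) = Num.sqrt pi :> R.
Proof.
pose G (t : R) := t `^ (1 / 2 - 1) * expR (- t).
have G0 t : 0 <= G t by rewrite mulr_ge0 ?powR_ge0 ?expR_ge0.
have mG : measurable_fun setT G by apply/measurable_EFinP; exact: measurable_powR_expRN.
have g0 (t : R) : 0 <= 2 * gauss_fun t by rewrite mulr_ge0// gauss_fun_ge0.
have mg : measurable_fun setT (fun t : R => 2 * gauss_fun t).
  by apply: measurable_funM => //; exact: measurable_gauss_fun.
suff E : (\int[mu]_(t in `]0%R, +oo[) (G t)%:E =
    \int[mu]_(t in `]0%R, +oo[) (2 * gauss_fun t)%:E)%E.
  rewrite /Gamma /Rintegral E integral_itv_obnd_cbnd; last first.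
    by apply/measurable_EFinP; apply: measurable_funTS.
  under eq_integral do rewrite EFinM.
  rewrite ge0_integralZl//.
  - by rewrite integral0y_gauss -EFinM/=; field.
  - by apply/measurable_EFinP; apply: measurable_funTS; exact: measurable_gauss_fun.
  - by move=> t _; rewrite lee_fin gauss_fun_ge0.
have cG := cvg_integral_pos_segment (isT : (0 < 2)%N) G0 mG.
have cg := cvg_integral_pos_segment (isT : (0 < 1)%N) g0 mg.
suff seqE : (fun n => \int[mu]_(t in pos_segment 2 n) (G t)%:E)%E =
    (fun n => \int[mu]_(t in pos_segment 1 n) (2 * gauss_fun t)%:E)%E.
  by rewrite seqE in cG; exact: (cvg_unique (@ereal_hausdorff R) cG cg).
apply/funext => n.
have n0 : 0 < n.+1%:R :> R by [].
have n1 : 1 <= n.+1%:R :> R by rewrite ler1n.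
pose a : R := (n.+1%:R)^-1; pose b : R := n.+1%:R.
have a0 : 0 < a by rewrite invr_gt0.
have ab : a <= b by rewrite (le_trans _ n1)// invf_le1.
pose F (t : R) := t ^+ 2.
have dF (t : R) : is_derive t (1 : R) F (2 * t).
  by rewrite /F; apply: is_derive_eq; rewrite /GRing.scale/=; ring.
have cF : continuous F by apply: derivable_continuous => t; have [] := dF t.
have F'E : derive1 F = (fun t => 2 * t).
  by apply/funext => t; rewrite derive1E; have [_] := dF t.
have cF' : continuous (fun t : R => 2 * t).
  by apply: derivable_continuous => t; exact: ex_derive.
have := @integration_by_substitution_increasing R F G a b ab.
rewrite F'E => subst.
rewrite /pos_segment expr1 -/a -/b -exprVn -/a -/(F a) -/(F b) subst.
- apply: eq_integral => t; rewrite inE /= in_itv /= => /andP[at_ _].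
  have t0 : 0 < t by exact: lt_le_trans at_.
  have pE : (t ^+ 2) `^ (1 / 2 - 1) = t^-1.
    rewrite -(powR_mulrn 2 (ltW t0)) -powRrM (_ : 2%:R * (1 / 2 - 1) = -1); last by field.
    by rewrite powR_inv1 ?(ltW t0).
  congr (_%:E); change (G (F t) * (2 * t) = 2 * gauss_fun t).
  by rewrite /G /F /gauss_fun pE; field; lra.
- move=> s t; rewrite !in_itv /= => /andP[as_ _] /andP[at_ _] st.
  by rewrite /F ltr_pXn2r// nnegrE; lra.
- by move=> t _; exact: cF'.
- by apply/cvg_ex; exists (2 * a); exact/cvg_at_right_filter/cF'.
- by apply/cvg_ex; exists (2 * b); exact/cvg_at_left_filter/cF'.
- split; first by move=> t _; have [] := dF t.
  + exact/cvg_at_right_filter/cF.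
  + exact/cvg_at_left_filter/cF.
- apply: derivable_within_continuous => t; rewrite in_itv /= => /andP[Fat _].
  have t0 : 0 < t by apply: lt_le_trans Fat; rewrite exprn_gt0.
  rewrite /G; apply: derivableM.
    by apply: derivable_powR; rewrite in_itv /= t0.
  exact: ex_derive.
Qed.

(** The right-hand side equals Gamma(5/2) pi / 2, by the values at 1/2 and 3. *)
Lemma Gamma_half_Beta_ge : pi / 2 <= Gamma (1 / 2) * Beta (5 / 2) (1 / 2) :> R.
Proof.
rewrite /Beta (_ : 5 / 2 + 1 / 2 = 3); last by field.
rewrite Gamma3 Gamma_half.
have -> : Num.sqrt pi * (Gamma (5 / 2) * Num.sqrt pi / 2) =
  Gamma (5 / 2) * (Num.sqrt pi ^+ 2) / 2 :> R by field.
rewrite sqr_sqrtr ?pi_ge0// ler_pM2r// ler_peMl ?pi_ge0//.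
exact: Gamma52_ge1.
Qed.

End GammaValues.

(** * Nonnegativity of the Landau constant *)

Section LandauConstant.
Context {R : realType}.
Implicit Types (t u : R).

Local Notation mu := (@lebesgue_measure R).

(* The phase v^3 / 3 + t v has derivative v^2 + t: integration by parts against
   1 / (v^2 + t), whose total variation on the half-line is 1 / t. *)
Lemma norm_Airy_integral_le t u : 0 < t -> 0 <= u ->
  `|\int[mu]_(v in `[0, u]) cos (v ^+ 3 / 3 + t * v)| <= t^-1.
Proof.
move=> t0 u0; pose phi (v : R) := v ^+ 3 / 3 + t * v.
pose g (v : R) := sin (phi v) * (2 * v / (v ^+ 2 + t) ^+ 2).
pose b (v : R) := 2 * v / (v ^+ 2 + t) ^+ 2.
have q0 (v : R) : 0 < v ^+ 2 + t by have := sqr_ge0 v; lra.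
have qn0 (v : R) : v ^+ 2 + t != 0 by rewrite lt0r_neq0.
have dq (v : R) : is_derive v (1 : R) (fun v : R => (v ^+ 2 + t)^-1) (- b v).
  have dv : is_derive v (1 : R) (fun v : R => v ^+ 2 + t) (2 * v).
    by apply: is_derive_eq; rewrite /GRing.scale/=; ring.
  have -> : - b v = - (v ^+ 2 + t) ^- 2 *: (2 * v).
    by rewrite /b /GRing.scale/=; field; exact: qn0.
  exact: (@is_deriveV R (fun v : R => v ^+ 2 + t) v (2 * v) 1 (qn0 v) dv).
have dF (v : R) : is_derive v (1 : R) (fun v => sin (phi v) * (v ^+ 2 + t)^-1)
    (cos (phi v) - g v).
  have dphi : is_derive v (1 : R) phi (v ^+ 2 + t).
    by rewrite /phi; apply: is_derive_eq; rewrite /GRing.scale/=; field.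
  have dsin : is_derive v (1 : R) (sin \o phi) (cos (phi v) * (v ^+ 2 + t)).
    by apply: is_derive_eq; rewrite /GRing.scale/=; ring.
  have dqv := dq v.
  have -> : cos (phi v) - g v = (sin \o phi) v *: - b v
      + (v ^+ 2 + t)^-1 *: (cos (phi v) * (v ^+ 2 + t)).
    by rewrite /g /b /GRing.scale/=; field; exact: qn0.
  exact: (@is_deriveM _ _ (sin \o phi) (fun v : R => (v ^+ 2 + t)^-1)).
have cphi : continuous phi.
  by rewrite /phi; apply: derivable_continuous => v; exact: ex_derive.
have ccos : continuous (fun v => cos (phi v)).
  by move=> v; apply: continuous_comp; [exact: cphi|exact: continuous_cos].
have csin : continuous (fun v => sin (phi v)).
  by move=> v; apply: continuous_comp; [exact: cphi|exact: continuous_sin].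
have cb : continuous b.
  move=> v; apply: cvgM.
    by apply: cvgM; [exact: cvg_cst|exact: cvg_id].
  apply: cvgV; first by rewrite expf_neq0.
  suff : continuous (fun v : R => (v ^+ 2 + t) ^+ 2) by apply.
  by apply: derivable_continuous => w; exact: ex_derive.
have cg : continuous g by move=> v; apply: cvgM; [exact: csin|exact: cb].
have cF : continuous (fun v => cos (phi v) - g v).
  by move=> v; apply: cvgB; [exact: ccos|exact: cg].
have E := Rintegral_FTC u0 cF dF.
rewrite RintegralB// in E; [|exact: continuous_integrable_itv..].
have B : `|\int[mu]_(v in `[0, u]) g v| <= t^-1 - (u ^+ 2 + t)^-1.
  have db (v : R) : is_derive v (1 : R) (fun v : R => - (v ^+ 2 + t)^-1) (b v).
    by have := dq v => h; apply: is_derive_eq; rewrite opprK.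
  have := Rintegral_FTC u0 cb db; rewrite expr0n/= add0r => bE.
  have -> : t^-1 - (u ^+ 2 + t)^-1 = - (u ^+ 2 + t)^-1 - - t^-1 by ring.
  rewrite -bE; apply: ler_norm_Rintegral => // v /andP[v0 _].
  have b0 : 0 <= b v.
    by apply: divr_ge0; [apply: mulr_ge0|exact: sqr_ge0].
  by rewrite normrM (ger0_norm b0) ler_piMl// sin_max.
have S : `|sin (phi u) * (u ^+ 2 + t)^-1| <= (u ^+ 2 + t)^-1.
  rewrite normrM (ger0_norm (_ : 0 <= (_ + _)^-1)); last by rewrite invr_ge0 ltW.
  by rewrite ler_piMl ?sin_max// invr_ge0 ltW.
have phi0 : sin (phi 0) = 0 by rewrite /phi expr0n/= mul0r mulr0 addr0 sin0.
rewrite phi0 mul0r subr0 in E.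
have -> : \int[mu]_(v in `[0, u]) cos (v ^+ 3 / 3 + t * v) =
    sin (phi u) * (u ^+ 2 + t)^-1 + \int[mu]_(v in `[0, u]) g v.
  by rewrite -E subrK.
by apply: (le_trans (ler_normD _ _)); lra.
Qed.

(* [lim] is 0 on divergent families, so that no convergence is needed here. *)
Lemma Airy_ge t : 0 < t -> - t^-1 <= Airy t.
Proof.
move=> t0; have p3 := pi_ge3 (R := R); have ti : 0 < t^-1 by rewrite invr_gt0.
have pi1 : 0 < (pi : R)^-1 <= 1.
  by rewrite invr_gt0 invf_le1 ?pi_gt0//; lra.
suff L : - t^-1 <= lim ((fun u => \int[mu]_(v in `[0, u]) cos (v ^+ 3 / 3 + t * v)) @ +oo).
  case/andP: pi1 => pi0 pi1; apply: le_trans (ler_wpM2l (ltW pi0) L).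
  by rewrite mulrN lerN2 ler_piMl// ltW.
set F := (X in lim (X @ _)); have [cF|dF] := pselect (cvg (F @ +oo)); last first.
  by rewrite (dvgP dF) (_ : point = 0)// oppr_le0 ltW.
apply: limr_ge => //; near=> u.
have u0 : 0 <= u by near: u; apply: nbhs_pinfty_ge; exact: num_real.
by have := norm_Airy_integral_le t0 u0; rewrite ler_norml => /andP[].
Unshelve. all: by end_near. Qed.

Lemma landau_b_ge0 : 0 <= landau_b R.
Proof.
rewrite mulr_ge0 ?powR_ge0//.
(* Without a supremum, [sup] has the default value 0. A negative supremum s is refuted at t = - 2 /
   s, where Ai(t) >= s / 2 > s. *)
have [hs|/sup_out->//] := pselect (has_sup (range (@Airy R))).
rewrite leNgt; apply/negP => s0; pose t : R := (- sup (range (@Airy R)) / 2)^-1.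
have t0 : 0 < t by rewrite invr_gt0; lra.
have : Airy t <= sup (range (@Airy R)) by apply: sup_upper_bound => //; exists t.
by have := Airy_ge t0; rewrite /t invrK; lra.
Qed.

End LandauConstant.

(** * Lower bound of the bracket *)

Section LowerBound.
Context {R : realType}.
Implicit Types (q s y : R).

Lemma amgm_sqrt_ge q s y : 0 < s -> 0 < y -> 4 * q <= 2 * q ^+ 2 / (s * y) + 2 * s * y.
Proof.
move=> s0 y0; have sy0 : 0 < s * y by rewrite mulr_gt0.
rewrite -subr_ge0.
have -> : 2 * q ^+ 2 / (s * y) + 2 * s * y - 4 * q = 2 * (q - s * y) ^+ 2 / (s * y).
  by field; lra.
by rewrite divr_ge0 ?(ltW sy0)// mulr_ge0// sqr_ge0.
Qed.

Lemma sqrt_pi_le2 : Num.sqrt pi <= 2 :> R.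
Proof.
by apply: ler_of_sqr; rewrite // sqr_sqrtr ?pi_ge0//; have := pi_le (R := R); lra.
Qed.

(** Both terms carry the factor 1 / sqrt(pi) >= 1/2 and are nonnegative because y >= 1. The
    inequality [amgm_sqrt_ge] then removes [delta], at the cost of - 2 sqrt x from the - 1 in y -
    1. *)
Lemma delta_terms_ge x tau delta : 0 < x -> 0 < tau -> 0 < delta ->
  4 * Num.sqrt (tau + 1 / 2) - 2 * Num.sqrt x <=
  2 / Num.sqrt (pi * x) * (1 + 2 * tau) * (1 + tau) `^ (- delta)
  + 4 * Num.sqrt x / Num.sqrt pi * ((1 + tau) `^ delta - 1) :> R.
Proof.
move=> x0 tau0 delta0; have p0 := pi_gt0 R.
rewrite powRN sqrtrM ?(ltW p0)//.
set y := (1 + tau) `^ delta; set s := Num.sqrt x; set p := Num.sqrt pi.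
have s0 : 0 < s by rewrite sqrtr_gt0.
have pp : 0 < p by rewrite sqrtr_gt0.
have y1 : 1 <= y.
  rewrite -[leLHS](powRr0 (1 + tau)) ler_powR//; first lra.
  exact: ltW.
have ip : 1 / 2 <= p^-1.
  by rewrite mul1r lef_pV2 ?posrE// sqrt_pi_le2.
have q2 : Num.sqrt (tau + 1 / 2) ^+ 2 = tau + 1 / 2 by rewrite sqr_sqrtr//; lra.
have y0 : 0 < y by lra.
have := amgm_sqrt_ge (Num.sqrt (tau + 1 / 2)) s0 y0; rewrite q2.
have -> : 2 / (p * s) * (1 + 2 * tau) / y = p^-1 * (2 * (1 + 2 * tau) / (s * y)) by field; lra.
have -> : 4 * s / p * (y - 1) = p^-1 * (4 * s * (y - 1)) by field; lra.
have a0 : 0 <= 2 * (1 + 2 * tau) / (s * y).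
  by rewrite divr_ge0 ?mulr_ge0 ?(ltW s0) ?(ltW y0)//; lra.
have b0 : 0 <= 4 * s * (y - 1) by rewrite !mulr_ge0 ?(ltW s0) ?subr_ge0.
have := ler_wpM2r a0 ip; have := ler_wpM2r b0 ip.
have -> : 2 * (tau + 1 / 2) / (s * y) = 1 / 2 * (2 * (1 + 2 * tau) / (s * y)) by field; lra.
by lra.
Qed.

Lemma Gamma_Beta_term_ge0 (n : nat) (a b c d : R) : 0 <= a ->
  0 <= a ^+ n * Gamma b * Beta c d.
Proof.
by move=> a0; apply: mulr_ge0; [apply: mulr_ge0; [exact: exprn_ge0|exact: Gamma_ge0]
  |exact: Beta_ge0].
Qed.

Lemma Gamma_Beta_sum_ge (M : nat) : (0 < M)%N ->
  pi / 2 <= \sum_(0 <= n < M) 4 ^+ n * Gamma (2 * n%:R + 1 / 2)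
    * Beta (2 * n%:R + 5 / 2) (2 * n%:R + 1 / 2) :> R.
Proof.
move=> M0; rewrite big_ltn// expr0 mul1r mulr0 !add0r.
rewrite -[leLHS]addr0; apply: lerD; first exact: Gamma_half_Beta_ge.
apply: sumr_ge0 => n _.
exact: Gamma_Beta_term_ge0.
Qed.

End LowerBound.

(** * Comparison of the two bounds *)

Theorem mainTheorem10 (R : realType) (x tau delta : R) (M N : nat)
    (hx : 0 < x) (htau : 0 < tau) (hdelta : 0 < delta)
    (hM : (0 < M)%N) (hN : (0 < N)%N) :
  `|macdonaldK tau x| <=
  Num.sqrt pi / Num.sqrt (tau * sinh (pi * tau)) *
  Num.sqrt
   (2 / Num.sqrt (pi * x) * (1 + 2 * tau) * (1 + tau) `^ (- delta)
    + 4 * Num.sqrt x / Num.sqrt pi * ((1 + tau) `^ delta - 1)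
    + 1
    + 2 * landau_b R * Num.sqrt (2 * x)
        * Num.sqrt (1 + landau_alpha R + 3 * landau_alpha R ^+ 2 / 10)
    + 4 * Num.sqrt x / pi *
        (\sum_(1 <= n < N)
            2 ^+ (2 * n - 1)%N * Gamma (2 * n%:R - 1 / 2)
              * Beta (2 * n%:R + 3 / 2) (2 * n%:R - 1 / 2)
         + \sum_(0 <= n < M)
            4 ^+ n * Gamma (2 * n%:R + 1 / 2)
              * Beta (2 * n%:R + 5 / 2) (2 * n%:R + 1 / 2))
    + 2 * Num.sqrt x / pi ^+ 2 *
        (4 ^+ N * Gamma (2 * N%:R - 3 / 2)
            * Beta (2 * N%:R - 3 / 2) (2 * N%:R + 1 / 2)
         + 4 ^+ (M - 1)%N * Gamma (2 * M%:R - 1 / 2)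
            * Beta (2 * M%:R - 1 / 2) (2 * M%:R + 3 / 2))).
Proof.
set S := (X in _ * Num.sqrt X).
have p0 := pi_gt0 R; have s0 : 0 < Num.sqrt x by rewrite sqrtr_gt0.
have SE : 1 + 4 * Num.sqrt (tau + 1 / 2) <= S.
  rewrite /S; set T1 := 2 / _ * _ * _; set T2 := 4 * _ / _ * _.
  set T4 := 2 * landau_b R * _ * _; set S1 := \sum_(1 <= n < N) _.
  set S2 := \sum_(0 <= n < M) _; set T6 := 2 * Num.sqrt x / _ * _.
  have D : 4 * Num.sqrt (tau + 1 / 2) - 2 * Num.sqrt x <= T1 + T2.
    exact: delta_terms_ge.
  have T40 : 0 <= T4.
    apply: mulr_ge0; last exact: sqrtr_ge0.
    by apply: mulr_ge0; [apply: mulr_ge0; [|exact: landau_b_ge0]|exact: sqrtr_ge0].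
  have S10 : 0 <= S1.
    by apply: sumr_ge0 => n _; exact: Gamma_Beta_term_ge0.
  have S2E : pi / 2 <= S2 by exact: Gamma_Beta_sum_ge.
  (* This makes up exactly for the - 2 sqrt x in [D]. *)
  have T5 : 2 * Num.sqrt x <= 4 * Num.sqrt x / pi * (S1 + S2).
    have -> : 2 * Num.sqrt x = 4 * Num.sqrt x / pi * (pi / 2) by field; lra.
    by rewrite ler_wpM2l ?divr_ge0 ?mulr_ge0 ?(ltW s0) ?(ltW p0)//; lra.
  have T60 : 0 <= T6.
    apply: mulr_ge0.
      by apply: divr_ge0; [apply: mulr_ge0 => //; exact: ltW|exact: sqr_ge0].
    by apply: addr_ge0; exact: Gamma_Beta_term_ge0.
  by lra.
have S0 : 0 <= S by apply: le_trans SE; rewrite addr_ge0 ?mulr_ge0 ?sqrtr_ge0.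
have sh : 0 < sinh (pi * tau).
  have pt : 0 < pi * tau by rewrite mulr_gt0.
  exact: lt_le_trans pt (sinh_ge (ltW pt)).
have d0 : 0 < tau * sinh (pi * tau) by rewrite mulr_gt0.
(* Squared and cleared of the denominator, the claim is tau sinh(pi tau) K^2 <= pi S. *)
apply: ler_of_sqr; first by rewrite mulr_ge0 ?divr_ge0 ?sqrtr_ge0.
rewrite real_normK ?num_real// exprMn expr_div_n !sqr_sqrtr ?(ltW p0) ?(ltW d0)//.
rewrite mulrAC ler_pdivlMr// mulrC.
apply: (le_trans (sinh_macdonaldK_sqr hx htau)).
by rewrite ler_wpM2l// ltW.
Qed.
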